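(* Assume that there is a constant $C_D$, independent of $k$, such that $|D_k|\le C_D h_{\mathcal T_k}$ a.e. in $\Omega$ for all $k\in\mathbb N$, and that for every $k\in\mathbb N$ every $L\in W(V_k,D_k)$ satisfies the discrete maximum principle. Let $\{\lambda_k\}_{k\in\mathbb N}\subset(0,1]$ with $\lambda_k\to0$ as $k\to\infty$. For each $k\in\mathbb N$, let $(u_k,m_k)\in V_k\times V_k$ and $(u_{k,\lambda_k},m_{k,\lambda_k})\in V_k\times V_k$ be the respective unique solutions of the finite element discretization of the mean field game partial differential inclusion (MFG PDI) and of the discretized regularized MFG system with $\lambda=\lambda_k$. Then, for all $k\in\mathbb N$, $$\|m_k-m_{k,\lambda_k}\|_\Omega\lesssim\lambda_k^{1/2},$$ where the hidden constant depends only on $\Omega$, $c_F$, $C_{\mathrm{stab}}$, $L_H$ and $\|G\|_{H^{-1}(\Omega)}$.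
   Context: Setting. $d\in\mathbb N$; $\Omega\subset\mathbb R^d$ is a bounded, connected, open polytopal set with Lipschitz boundary. $(\cdot,\cdot)_\Omega$ and $\|\cdot\|_\Omega$ denote the $L^2(\Omega)$ inner product and norm (for scalar functions or vector fields). $H^{-1}(\Omega)$ is the dual of $H^1_0(\Omega)$ with norm $\|\Psi\|_{H^{-1}(\Omega)}=\sup\{\langle\Psi,v\rangle_{H^{-1}\times H^1_0}: v\in H^1_0(\Omega),\ \|\nabla v\|_\Omega\le 1\}$. $|\cdot|$ is the Frobenius norm on matrices. Data. $\nu>0$ is a constant. $G\in H^{-1}(\Omega)$ has the form $G=g_0-\nabla\cdot g_1$ with $g_0\in L^{q/2}(\Omega)$, $g_1\in L^q(\Omega;\mathbb R^d)$ for some $q>d$, and $\langle G,v\rangle_{H^{-1}\times H^1_0}\ge0$ for all $v\in H^1_0(\Omega)$ with $v\ge0$ a.e. $F:L^2(\Omega)\to L^2(\Omega)$ satisfies $\|F[m_1]-F[m_2]\|_\Omega\le L_F\|m_1-m_2\|_\Omega$ for all $m_1,m_2\in L^2(\Omega)$ and, for some $c_F>0$, $(F[m_1]-F[m_2],m_1-m_2)_\Omega\ge c_F\|m_1-m_2\|_\Omega^2$ for all $m_1,m_2\in H^1_0(\Omega)$. $\mathcal A$ is a compact metric space, $b:\overline\Omega\times\mathcal A\to\mathbb R^d$ and $f:\overline\Omega\times\mathcal A\to\mathbb R$ are uniformly continuous, and $H(x,p)=\sup_{\alpha\in\mathcal A}\{b(x,\alpha)\cdot p-f(x,\alpha)\}$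 for $(x,p)\in\overline\Omega\times\mathbb R^d$. $L_H=\|b\|_{C(\overline\Omega\times\mathcal A;\mathbb R^d)}$ is a Lipschitz constant of $H$ in $p$; it is assumed that $L_H>0$. Write $H[\nabla v]=H(\cdot,\nabla v)$. Subdifferential. $\partial_pH(x,p)=\{\tilde b\in\mathbb R^d: H(x,q)\ge H(x,p)+\tilde b\cdot(q-p)\ \forall q\in\mathbb R^d\}$, and for $v\in W^{1,1}(\Omega)$, $D_pH[v]=\{\tilde b\in L^\infty(\Omega;\mathbb R^d):\tilde b(x)\in\partial_pH(x,\nabla v(x))\text{ for a.e. }x\in\Omega\}$. Meshes. $\{\mathcal T_k\}_{k\in\mathbb N}$ is a sequence of conforming simplicial meshes of $\Omega$, nested (each element of $\mathcal T_{k+1}$ is an element of $\mathcal T_k$ or belongs to a subdivision of one), and uniformly shape-regular: there is $\delta>1$ independent of $k$ with $\operatorname{diam}K\le\delta\rho_K$ for all $K\in\mathcal T_k$, where $\rho_K$ is the radius of the largest ball inscribed in $K$. $h_{\mathcal T_k}\in L^\infty(\Omega)$ is defined by $h_{\mathcal T_k}|_K=\operatorname{diam}K$; $h_k=\|h_{\mathcal T_k}\|_{L^\infty(\Omega)}$, and $h_k\to0$ as $k\to\infty$. $V_k=\{v_k\in H^1_0(\Omega): v_k|_K\text{ affine for all }K\in\mathcal T_k\}$, with nodal basis $\{\xi_i\}_{i=1}^{M_k}$ associated with the interior vertices; $V_k^*$ is its dual with norm $\|\Psi\|_{V_k^*}=\sup_{v_k\in V_k\setminus\{0\}}\langle\Psi,v_k\rangle/\|v_k\|_{H^1(\Omega)}$.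 Stabilization. For each $k$, $D_k\in L^\infty(\Omega;\mathbb R^{d\times d}_{\mathrm{sym},+})$ (symmetric positive semidefinite matrix-valued) is given, and $A_k=\nu\mathbb I_d+D_k$. $W(V_k,D_k)$ is the set of linear operators $L:V_k\to V_k^*$ of the form $\langle Lw_k,v_k\rangle=(A_k\nabla w_k,\nabla v_k)_\Omega+(\tilde b\cdot\nabla w_k,v_k)_\Omega$ with $\tilde b\in L^\infty(\Omega;\mathbb R^d)$, $\|\tilde b\|_{L^\infty(\Omega;\mathbb R^d)}\le L_H$. $L:V_k\to V_k^*$ satisfies the discrete maximum principle if: $v_k\in V_k$ and $\langle Lv_k,\xi_i\rangle\ge0$ for all $i$ imply $v_k\ge0$ in $\Omega$. The adjoint is $\langle L^*w_k,v_k\rangle=\langle Lv_k,w_k\rangle$. Under the two assumptions on $D_k$ in the claim it is known that there is a constant $C_{\mathrm{stab}}>0$, independent of $k$, such that $\|w_k\|_{H^1(\Omega)}\le C_{\mathrm{stab}}\|Lw_k\|_{V_k^*}$ and $\|w_k\|_{H^1(\Omega)}\le C_{\mathrm{stab}}\|L^*w_k\|_{V_k^*}$ for all $w_k\in V_k$, $L\in W(V_k,D_k)$, $k\in\mathbb N$. Finite element discretization of the MFG PDI: $(u_k,m_k)\in V_k\times V_k$ for which there exists $\tilde b_k\in D_pH[u_k]$ with $(A_k\nabla u_k,\nabla v_k)_\Omega+(H[\nabla u_k],v_k)_\Omega=(F[m_k],v_k)_\Omega$ for all $v_k\in V_k$ and $(A_k\nabla m_k,\nabla w_k)_\Omega+(m_k\tilde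 b_k,\nabla w_k)_\Omega=\langle G,w_k\rangle_{H^{-1}\times H^1_0}$ for all $w_k\in V_k$. Under the assumptions in the claim, exactly one such pair exists for each $k$. Regularization. For $\lambda\in(0,1]$, $H_\lambda(x,p)=\inf_{q\in\mathbb R^d}\{H(x,q)+\frac1{2\lambda}|q-p|^2\}$ (Moreau–Yosida regularization), which is convex and differentiable in $p$; write $H_\lambda[\nabla v]=H_\lambda(\cdot,\nabla v)$ and $\frac{\partial H_\lambda}{\partial p}[\nabla v]=\frac{\partial H_\lambda}{\partial p}(\cdot,\nabla v)$. Discretized regularized MFG system: $(u_{k,\lambda},m_{k,\lambda})\in V_k\times V_k$ satisfies $(A_k\nabla u_{k,\lambda},\nabla v_k)_\Omega+(H_\lambda[\nabla u_{k,\lambda}],v_k)_\Omega=(F[m_{k,\lambda}],v_k)_\Omega$ for all $v_k\in V_k$ and $(A_k\nabla m_{k,\lambda},\nabla w_k)_\Omega+(m_{k,\lambda}\frac{\partial H_\lambda}{\partial p}[\nabla u_{k,\lambda}],\nabla w_k)_\Omega=\langle G,w_k\rangle_{H^{-1}\times H^1_0}$ for all $w_k\in V_k$. Under the assumptions in the claim, it has exactly one solution for each $k$ and $\lambda$. Notation: $a\lesssim b$ means $a\le Cb$ with a constant $C$ independent of $k$ and of the regularization parameters (here with the dependence stated in the claim). *)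

(* Defs.v *)
From HB Require Import structures.
From mathcomp Require Import all_boot all_order all_algebra.
From mathcomp Require Import all_classical all_reals all_analysis.

Set Implicit Arguments.
Unset Strict Implicit.
Unset Printing Implicit Defensive.

Import Order.TTheory GRing.Theory Num.Theory.
Import numFieldNormedType.Exports.

Local Open Scope classical_set_scope.
Local Open Scope ring_scope.

(* The sigma-algebra generated by the coordinates, i.e. the Borel one. *)
Section measurable_rV.
Variables (R : realType) (n : nat).

Let coord (i : 'I_n) (v : 'rV[R]_n) : R := v 0 i.

Let rV_set0 : g_sigma_preimage coord set0.
Proof. exact: sigma_algebra0. Qed.

Let rV_setC A : g_sigma_preimage coord A -> g_sigma_preimage coord (~` A).
Proof. exact: sigma_algebraC. Qed.

Let rV_bigcup (F : (set 'rV[R]_n)^nat) :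
  (forall i, g_sigma_preimage coord (F i)) ->
  g_sigma_preimage coord (\bigcup_i F i).
Proof. exact: sigma_algebra_bigcup. Qed.

HB.instance Definition _ :=
  @isMeasurable.Build default_measure_display 'rV[R]_n
    (g_sigma_preimage coord) rV_set0 rV_setC rV_bigcup.

End measurable_rV.

Section lebesgue_rV_succ.
Variables (R : realType) (n : nat).
Variable mu : {sigma_finite_measure set 'rV[R]_n -> \bar R}.

Definition rV_cons (p : R * 'rV[R]_n) : 'rV[R]_n.+1 := row_mx p.1%:M p.2.

Lemma measurable_rV_coord m (i : 'I_m) :
  measurable_fun setT (fun v : 'rV[R]_m => v 0 i).
Proof.
move=> _ Y mY; apply: sub_sigma_algebra.
rewrite -bigcup_seq/=; exists i => /=; first by rewrite mem_index_enum.
by exists Y.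
Qed.

Lemma measurable_fun_rV d (T : measurableType d) m (f : T -> 'rV[R]_m) :
  (forall i, measurable_fun setT (fun t => f t 0 i)) -> measurable_fun setT f.
Proof.
move=> mf _ Y; rewrite setTI.
suff : measurable `<=` [set A : set 'rV[R]_m | measurable (f @^-1` A)] by exact.
apply: smallest_sub.
  split; rewrite /=.
  - by rewrite preimage_set0.
  - by move=> A mA; rewrite setTD preimage_setC; exact: measurableC.
  - by move=> F mF; rewrite preimage_bigcup; exact: bigcup_measurable.
rewrite -bigcup_seq => A [i _ [B mB <-]] /=.
by rewrite setTI -comp_preimage -[X in measurable X]setTI; exact: mf.
Qed.

Lemma rV_cons0 p : rV_cons p 0 0 = p.1.
Proof.
rewrite /rV_cons mxE; case: splitP => j /= j0; last by [].
by rewrite !mxE ord1 eqxx mulr1n.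
Qed.

Lemma rV_consS p i : rV_cons p 0 (lift ord0 i) = p.2 0 i.
Proof.
rewrite /rV_cons mxE; case: splitP => j /=.
  by rewrite ord1.
by rewrite /bump/= !add1n => -[] ij; congr (p.2 _ _); exact/val_inj.
Qed.

Lemma measurable_rV_cons : measurable_fun setT rV_cons.
Proof.
apply: measurable_fun_rV => i; have [j ->|->] := unliftP ord0 i.
  under eq_fun do rewrite rV_consS.
  exact: (measurableT_comp (measurable_rV_coord j)).
under eq_fun do rewrite rV_cons0.
exact: measurable_fst.
Qed.

Definition lebesgue_rVS (A : set 'rV[R]_n.+1) : \bar R :=
  ((@lebesgue_measure R) \x mu)%E (rV_cons @^-1` A).

Let preim_measurable A : measurable A -> measurable (rV_cons @^-1` A).
Proof. by move=> mA; rewrite -[X in measurable X]setTI; exact: measurable_rV_cons. Qed.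

Let lebesgue_rVS0 : lebesgue_rVS set0 = 0%E.
Proof. by rewrite /lebesgue_rVS preimage_set0 measure0. Qed.

Let lebesgue_rVS_ge0 A : (0 <= lebesgue_rVS A)%E.
Proof. exact: measure_ge0. Qed.

Let lebesgue_rVS_sigma_additive : semi_sigma_additive lebesgue_rVS.
Proof.
move=> F mF tF mUF; rewrite /lebesgue_rVS preimage_bigcup.
apply: measure_semi_sigma_additive.
- by move=> k; exact: preim_measurable.
- apply/trivIsetP => /= i j _ _ ij; rewrite -preimage_setI.
  by move/trivIsetP : tF => /(_ _ _ _ _ ij) ->//; rewrite preimage_set0.
- by rewrite -preimage_bigcup; exact: preim_measurable.
Qed.

HB.instance Definition _ := isMeasure.Build _ _ _
  lebesgue_rVS lebesgue_rVS0 lebesgue_rVS_ge0 lebesgue_rVS_sigma_additive.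

Let lebesgue_rVS_sigma_finite : sigma_finite setT lebesgue_rVS.
Proof.
have /sigma_finiteP[/= F [UF ndF mF]] := sigma_finiteT (@lebesgue_measure R).
have /sigma_finiteP[/= G [UG ndG mG]] := sigma_finiteT mu.
exists (fun k => [set v : 'rV[R]_n.+1 | F k (v 0 0) /\
    G k (\row_i v 0 (lift ord0 i))]).
  apply/seteqP; split => // v _.
  have [i _ Fi] : (\bigcup_i F i) (v 0 0) by rewrite -UF.
  have [j _ Gj] : (\bigcup_i G i) (\row_i v 0 (lift ord0 i)) by rewrite -UG.
  exists (maxn i j) => //; split.
    by have /subsetPset := ndF _ _ (leq_maxl i j); exact.
  by have /subsetPset := ndG _ _ (leq_maxr i j); exact.
move=> k; split.
  apply: measurableI.
    rewrite -[X in measurable X]setTI.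
    by apply: measurable_rV_coord => //; exact: (mF k).1.
  rewrite -[X in measurable X]setTI.
  apply: (@measurable_fun_rV _ _ n (fun v : 'rV[R]_n.+1 => \row_i v 0 (lift ord0 i))) => //.
    by move=> i; under eq_fun do rewrite mxE; exact: measurable_rV_coord.
  exact: (mG k).1.
rewrite /lebesgue_rVS (_ : _ @^-1` _ = F k `*` G k).
  rewrite product_measure1E//; [|exact: (mF k).1|exact: (mG k).1].
  apply: lte_mul_pinfty => //.
  - by rewrite ge0_fin_numE//; exact: (mF k).2.
  - exact: (mG k).2.
apply/seteqP; split => -[x v] /=; rewrite rV_cons0/=.
  move=> [Fx]; rewrite (_ : (\row_i _) = v)//.
  by apply/rowP => i; rewrite mxE rV_consS.
move=> [Fx Gv]; split => //; rewrite (_ : (\row_i _) = v)//.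
by apply/rowP => i; rewrite mxE rV_consS.
Qed.

HB.instance Definition _ := Measure_isSigmaFinite.Build _ _ _
  lebesgue_rVS lebesgue_rVS_sigma_finite.

End lebesgue_rV_succ.

Fixpoint lebesgue_rV (R : realType) (n : nat) :
    {sigma_finite_measure set 'rV[R]_n -> \bar R} :=
  match n with
  | 0%N => \d_ (0 : 'rV[R]_0)
  | m.+1 => lebesgue_rVS (lebesgue_rV R m)
  end.

Lemma lebesgue_rV_box (R : realType) (n : nat) (A : 'I_n -> set R) :
  (forall i, measurable (A i)) ->
  lebesgue_rV R n [set v | forall i, A i (v 0 i)] =
  (\prod_(i < n) lebesgue_measure (A i))%E.
Proof.
elim: n A => [|n IH] A mA.
  by rewrite big_ord0 /= diracE mem_set// => -[].
have mB : measurable [set v : 'rV[R]_n | forall i, A (lift ord0 i) (v 0 i)].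
  have -> : [set v : 'rV[R]_n | forall i, A (lift ord0 i) (v 0 i)] =
      \bigcap_(i in [set: 'I_n])
        ((fun v : 'rV[R]_n => v 0 i) @^-1` A (lift ord0 i)).
    by apply/seteqP; split => v /= Av i => [_|]; exact: Av.
  apply: fin_bigcap_measurable => // i _; rewrite -[X in measurable X]setTI.
  exact: measurable_rV_coord.
rewrite big_ord_recl -IH// -product_measure1E//; last exact: mA.
rewrite /= /lebesgue_rVS; congr ((_ \x _)%E _).
apply/seteqP; split => -[x v] /= Av.
  split=> [|i]; first by have := Av ord0; rewrite rV_cons0.
  by have := Av (lift ord0 i); rewrite rV_consS.
by move=> i; have [j ->|->] := unliftP ord0 i; rewrite ?rV_consS ?rV_cons0;
  [exact: Av.2|exact: Av.1].
Qed.

Section euclidean.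
Variable R : realType.

(* The library norm on matrices is the maximum norm; this is the Frobenius
   norm, hence the Euclidean norm on row vectors. *)
Definition fnorm (m n : nat) (A : 'M[R]_(m, n)) : R :=
  Num.sqrt (\sum_i \sum_j A i j ^+ 2).

Definition dot (n : nat) (p q : 'rV[R]_n) : R := \sum_i p 0 i * q 0 i.

Definition grad (n : nat) (h : 'rV[R]_n -> R) (p : 'rV[R]_n) : 'rV[R]_n :=
  \row_i 'D_(delta_mx 0 i) h p.

Definition conv_hull (n : nat) (X : set 'rV[R]_n) : set 'rV[R]_n :=
  [set x | exists (m : nat) (t : 'I_m -> R) (p : 'I_m -> 'rV[R]_n),
     [/\ forall i, 0 <= t i, \sum_i t i = 1, forall i, X (p i) &
         x = \sum_i t i *: p i]].

Definition diam (n : nat) (X : set 'rV[R]_n) : R :=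
  sup [set fnorm (z.1 - z.2) | z in X `*` X].

Definition inradius (n : nat) (X : set 'rV[R]_n) : R :=
  sup [set r | 0 <= r /\ exists x, [set y | fnorm (y - x) <= r] `<=` X].

End euclidean.

Section domain.
Variables (R : realType) (d : nat).
Local Notation Rd := 'rV[R]_d.

(* Near every boundary point, and in some direction e, the set is the strict
   epigraph of a Lipschitz function of the component orthogonal to e. *)
Definition lipschitz_boundary (Om : set Rd) : Prop :=
  forall x, (closure Om `\` Om) x ->
  exists (e : Rd) (L : R) (gamma : Rd -> R), [/\ fnorm e = 1,
    forall y z, dot y e = 0 -> dot z e = 0 ->
      `|gamma y - gamma z| <= L * fnorm (y - z) &
    \forall y \near x, Om y <-> gamma (y - dot y e *: e) < dot y e].

Definition polytopal (Om : set Rd) : Prop :=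
  exists P : seq (seq Rd),
    closure Om = \bigcup_(p in [set` P]) conv_hull [set` p].

Definition polytopal_domain (Om : set Rd) : Prop :=
  [/\ open Om, connected Om, bounded_set Om, polytopal Om &
      lipschitz_boundary Om].

End domain.

Section lebesgue_spaces.
Variables (R : realType) (d : nat) (Om : set 'rV[R]_d).
Local Notation Rd := 'rV[R]_d.
Local Notation leb := (lebesgue_rV R d).

Definition ip (f g : Rd -> R) : R := \int[leb]_(x in Om) (f x * g x).

Definition vip (f g : Rd -> Rd) : R := \int[leb]_(x in Om) dot (f x) (g x).

Definition Lpnorm (p : \bar R) (f : Rd -> R) : \bar R :=
  'N[leb]_p[EFin \o (f \_ Om)].

Definition Lp (p : \bar R) (f : Rd -> R) : Prop :=
  measurable_fun Om f /\ (Lpnorm p f < +oo)%E.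

Definition Lpnorm_mx (p : \bar R) (m n : nat) (f : Rd -> 'M[R]_(m, n)) : \bar R :=
  Lpnorm p (fun x => fnorm (f x)).

Definition Lp_mx (p : \bar R) (m n : nat) (f : Rd -> 'M[R]_(m, n)) : Prop :=
  (forall i j, measurable_fun Om (fun x => f x i j)) /\
  (Lpnorm_mx p f < +oo)%E.

Definition L2norm (f : Rd -> R) : R := fine (Lpnorm 2%:E f).

Definition L2norm_mx (m n : nat) (f : Rd -> 'M[R]_(m, n)) : R :=
  fine (Lpnorm_mx 2%:E f).

Definition ae_in (P : Rd -> Prop) : Prop := {ae leb, forall x, Om x -> P x}.

End lebesgue_spaces.

(* A Sobolev function is handled as the pair v of the function v.1 and of its
   weak gradient v.2. *)
Notation sobolev R d := (('rV[R]_d -> R) * ('rV[R]_d -> 'rV[R]_d))%type.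

Section sobolev_spaces.
Variables (R : realType) (d : nat) (Om : set 'rV[R]_d).
Local Notation Rd := 'rV[R]_d.
Local Notation sob := (sobolev R d).

(* C^infinity: differentiability at the next order makes the derivatives of
   each order continuous. *)
Definition smooth (phi : Rd -> R) : Prop :=
  forall (s : seq Rd) (x : Rd),
    differentiable (foldr (fun w (h : Rd -> R) => 'D_w h) phi s) x.

Definition test_fun (phi : Rd -> R) : Prop :=
  [/\ smooth phi, compact (closure [set x | phi x != 0]) &
      closure [set x | phi x != 0] `<=` Om].

(* The closure of the test functions for the H^1 norm; the limit of the
   gradients of the approximating test functions is the weak gradient. *)
Definition H10 (v : sob) : Prop :=
  [/\ Lp Om 2%:E v.1, Lp_mx Om 2%:E v.2 &
    exists phi : nat -> Rd -> R,
      [/\ forall j, test_fun (phi j),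
          Lpnorm Om 2%:E (phi j \- v.1) @[j --> \oo] --> 0%E &
          Lpnorm_mx Om 2%:E (grad (phi j) \- v.2) @[j --> \oo] --> 0%E]].

Definition H1norm (v : sob) : R :=
  Num.sqrt (L2norm Om v.1 ^+ 2 + L2norm_mx Om v.2 ^+ 2).

Definition Hm1norm (G : sob -> R) : \bar R :=
  ereal_sup [set (G v)%:E | v in [set v | H10 v /\ L2norm_mx Om v.2 <= 1]].

Definition Hm1 (G : sob -> R) : Prop :=
  (forall (a : R) (v w : sob), H10 v -> H10 w ->
     G (a *: v + w) = a * G v + G w) /\
  (Hm1norm G < +oo)%E.

(* G = g0 - div g1 in the sense of distributions. *)
Definition Hm1_rep (G : sob -> R) (g0 : Rd -> R) (g1 : Rd -> Rd) : Prop :=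
  forall phi, test_fun phi ->
    G (phi, grad phi) = ip Om g0 phi + vip Om g1 (grad phi).

Definition Hm1_ge0 (G : sob -> R) : Prop :=
  forall v, H10 v -> ae_in Om (fun x => 0 <= v.1 x) -> 0 <= G v.

End sobolev_spaces.

Section coupling.
Variables (R : realType) (d : nat) (Om : set 'rV[R]_d).
Variable F : ('rV[R]_d -> R) -> 'rV[R]_d -> R.

Definition coupling_lipschitz (LF : R) : Prop :=
  forall m1 m2, Lp Om 2%:E m1 -> Lp Om 2%:E m2 ->
    L2norm Om (F m1 \- F m2) <= LF * L2norm Om (m1 \- m2).

Definition coupling_monotone (cF : R) : Prop :=
  forall m1 m2 : sobolev R d, H10 Om m1 -> H10 Om m2 ->
    cF * L2norm Om (m1.1 \- m2.1) ^+ 2 <=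
    ip Om (F m1.1 \- F m2.1) (m1.1 \- m2.1).

End coupling.

Section hamiltonian.
Variables (R : realType) (d : nat) (Om : set 'rV[R]_d).
Variables (A : metricType R).
Local Notation Rd := 'rV[R]_d.

Definition unif_continuous_on (V : pseudoMetricType R) (b : Rd -> A -> V) : Prop :=
  forall e : R, 0 < e -> exists2 r : R, 0 < r &
    forall x y a a', closure Om x -> closure Om y -> ball x r y ->
      ball a r a' -> ball (b x a) e (b y a').

Definition hamiltonian (b : Rd -> A -> Rd) (f : Rd -> A -> R) (x p : Rd) : R :=
  sup [set dot (b x a) p - f x a | a in [set: A]].

Definition drift_sup (b : Rd -> A -> Rd) : R :=
  sup [set fnorm (b z.1 z.2) | z in closure Om `*` [set: A]].

Definition moreau_yosida (H : Rd -> Rd -> R) (lam : R) (x p : Rd) : R :=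
  inf [set H x q + (2 * lam)^-1 * fnorm (q - p) ^+ 2 | q in [set: Rd]].

Definition subdiff (H : Rd -> Rd -> R) (x p : Rd) : set Rd :=
  [set c | forall q, H x p + dot c (q - p) <= H x q].

Definition DpH (H : Rd -> Rd -> R) (v : sobolev R d) : set (Rd -> Rd) :=
  [set c | Lp_mx Om +oo%E c /\ ae_in Om (fun x => subdiff H x (v.2 x) (c x))].

End hamiltonian.

Section meshes.
Variables (R : realType) (d : nat) (Om : set 'rV[R]_d).
Local Notation Rd := 'rV[R]_d.
Local Notation splx := {ffun 'I_d.+1 -> Rd}.

Definition simplex (K : splx) : set Rd := conv_hull (range K).

Definition nondegenerate (K : splx) : Prop :=
  row_free (\matrix_(i < d) (K (lift ord0 i) - K ord0)).

Definition conforming (T : seq splx) (X : set Rd) : Prop :=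
  [/\ forall K, K \in T -> nondegenerate K,
      \bigcup_(K in [set` T]) simplex K = X &
      forall K K', K \in T -> K' \in T ->
        simplex K `&` simplex K' = conv_hull (range K `&` range K')].

Definition mesh (T : seq splx) : Prop := conforming T (closure Om).

Definition refines (T' T : seq splx) : Prop :=
  forall K, K \in T' -> exists2 K0, K0 \in T &
    simplex K = simplex K0 \/
    exists2 S, conforming S (simplex K0) & K \in S.

Definition shape_regular (delta : R) (T : seq splx) : Prop :=
  forall K, K \in T -> diam (simplex K) <= delta * inradius (simplex K).

(* The value on the null set of the faces is immaterial. *)
Definition meshsize (T : seq splx) (x : Rd) : R :=
  \big[Num.max/0]_(K <- T | x \in simplex K) diam (simplex K).

Definition vertex (T : seq splx) (x : Rd) : Prop :=
  exists2 K, K \in T & range K x.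

(* Being affine on every closed simplex selects the continuous representative. *)
Definition Vh (T : seq splx) (v : sobolev R d) : Prop :=
  H10 Om v /\
  forall K, K \in T -> exists (p : Rd) (c : R),
    forall x, simplex K x -> v.1 x = dot p x + c.

Definition nodal (T : seq splx) (a : Rd) (xi : sobolev R d) : Prop :=
  [/\ Vh T xi, xi.1 a = 1 & forall y, vertex T y -> y <> a -> xi.1 y = 0].

(* Division by 0 gives 0, so v = 0 contributes the value 0; the supremum is
   then 0, not -oo, on a mesh without interior vertices. *)
Definition Vh_dual_norm (T : seq splx) (Psi : sobolev R d -> R) : \bar R :=
  ereal_sup [set (Psi v / H1norm Om v)%:E | v in Vh T].

End meshes.

Section discretization.
Variables (R : realType) (d : nat) (Om : set 'rV[R]_d).
Local Notation Rd := 'rV[R]_d.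
Local Notation splx := {ffun 'I_d.+1 -> Rd}.
Local Notation sob := (sobolev R d).

Definition sym_psd (M : 'M[R]_d) : Prop :=
  M^T = M /\ forall p : Rd, 0 <= dot (p *m M^T) p.

Definition stabilization (D : Rd -> 'M[R]_d) : Prop :=
  Lp_mx Om +oo%E D /\ ae_in Om (fun x => sym_psd (D x)).

Definition diffusion (nu : R) (D : Rd -> 'M[R]_d) (w v : sob) : R :=
  vip Om (fun x => w.2 x *m (nu%:M + D x)^T) v.2.

(* An operator L from V_h to its dual is the form L w v = <L w, v>. *)
Definition W_op (T : seq splx) (LH nu : R) (D : Rd -> 'M[R]_d)
    : set (sob -> sob -> R) :=
  [set L | exists c : Rd -> Rd,
    [/\ Lp_mx Om +oo%E c, (Lpnorm_mx Om +oo%E c <= LH%:E)%E &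
        forall w v, Vh Om T w -> Vh Om T v ->
          L w v = diffusion nu D w v + ip Om (fun x => dot (c x) (w.2 x)) v.1]].

Definition adjoint (L : sob -> sob -> R) : sob -> sob -> R := fun w v => L v w.

Definition dmp (T : seq splx) (L : sob -> sob -> R) : Prop :=
  forall v, Vh Om T v ->
    (forall a xi, vertex T a -> Om a -> nodal Om T a xi -> 0 <= L v xi) ->
    forall x, Om x -> 0 <= v.1 x.

Definition stable (T : seq splx) (Cstab : R) (L : sob -> sob -> R) : Prop :=
  forall w, Vh Om T w ->
    ((H1norm Om w)%:E <= Cstab%:E * Vh_dual_norm Om T (L w))%E.

Definition HJB_eq (T : seq splx) (nu : R) (D : Rd -> 'M[R]_d)
    (H : Rd -> Rd -> R) (F : (Rd -> R) -> Rd -> R) (u m : sob) : Prop :=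
  forall v, Vh Om T v ->
    diffusion nu D u v + ip Om (fun x => H x (u.2 x)) v.1 = ip Om (F m.1) v.1.

Definition KFP_eq (T : seq splx) (nu : R) (D : Rd -> 'M[R]_d)
    (c : Rd -> Rd) (G : sob -> R) (m : sob) : Prop :=
  forall w, Vh Om T w ->
    diffusion nu D m w + vip Om (fun x => m.1 x *: c x) w.2 = G w.

Definition MFG_PDI_sol (T : seq splx) (nu : R) (D : Rd -> 'M[R]_d)
    (H : Rd -> Rd -> R) (F : (Rd -> R) -> Rd -> R) (G : sob -> R)
    (u m : sob) : Prop :=
  [/\ Vh Om T u, Vh Om T m &
    exists c, [/\ DpH Om H u c, HJB_eq T nu D H F u m & KFP_eq T nu D c G m]].

Definition MFG_reg_sol (T : seq splx) (nu : R) (D : Rd -> 'M[R]_d)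
    (H : Rd -> Rd -> R) (F : (Rd -> R) -> Rd -> R) (G : sob -> R) (lam : R)
    (u m : sob) : Prop :=
  [/\ Vh Om T u, Vh Om T m,
    HJB_eq T nu D (moreau_yosida H lam) F u m &
    KFP_eq T nu D (fun x => grad (moreau_yosida H lam x) (u.2 x)) G m].

End discretization.

(* Main.v *)
Require Import Defs.
From HB Require Import structures.
From mathcomp Require Import all_boot all_order all_algebra.
From mathcomp Require Import all_classical all_reals all_analysis.
From mathcomp Require Import ess_sup_inf measurable_realfun.
From mathcomp Require Import ring lra.

Import Order.TTheory GRing.Theory Num.Theory.
Import numFieldNormedType.Exports.

Local Open Scope classical_set_scope.
Local Open Scope ring_scope.

Set Implicit Arguments.
Unset Strict Implicit.
Unset Printing Implicit Defensive.

(** Write H_lam for the Moreau-Yosida regularization of H, c for the selection of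
    the subdifferential in the first system, and c_lam for the gradient of H_lam
    at the gradient of ul. Cross-testing the two systems as in the classical
    uniqueness argument for mean field games eliminates the diffusion and gives
    - (F[m] - F[ml], m - ml) = (H[ul] - H_lam[ul], m) - (phi, m) - (phi', ml),
    - phi = H[ul] - H[u] - c . (grad ul - grad u),
    - phi' = H[u] - H_lam[ul] - c_lam . (grad u - grad ul).
    Both phi and phi' are nonnegative: the first because c is a subgradient of H,
    the second because H >= H_lam and c_lam is a subgradient of H_lam. As H is
    LH-Lipschitz, 0 <= H - H_lam <= lam LH^2 / 2. If the terms with phi and phi'
    have the right sign, strong monotonicity of F and the Cauchy-Schwarz
    inequality give cF |m - ml|^2 <= lam LH^2 / 2 |1| |m|, in L^2 norms, and
    stability of the adjoint operator bounds |m| by Cstab |G|. This is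
    density_gap_le.

    The sign of (phi, m) for phi >= 0 is obtained by duality, in
    discrete_density_ge0. The density m solves L^* m = G, where L is the
    advection-diffusion operator with drift c. Let v in V_h solve L v = phi. The
    nodal functions are nonnegative, by convexity on each simplex, so the
    discrete maximum principle yields v >= 0, and (phi, m) = <L v, m> = <G, v>,
    which is nonnegative.

    Solvability of L v = phi is linear algebra (form_solvable) once V_h is known
    to be finite-dimensional: an element of V_h that vanishes at all vertices
    vanishes on Om, and one needs that its weak gradient vanishes too, the weak
    gradient being a datum of its own. That is H10_grad_eq0, which follows from
    integration by parts against test functions, hence from the fact that
    derivatives of compactly supported functions have zero mean
    (integral_partial_eq0).

    The remaining work is to show that the functions of x which are integrated
    are measurable and square-integrable: H and H_lam are continuous in x and
    Lipschitz in p, so they compose with measurable fields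
    (measurable_caratheodory), and H_lam is differentiable in p, with a
    quadratic error that makes its gradient a limit of measurable difference
    quotients (moreau_quadratic, measurable_moreau_grad). *)

(** * Measurability for the Borel structure generated by the coordinates *)

Section measurability.
Context (R : realType) (n : nat).
Implicit Types (x : 'rV[R]_n) (k : nat).

(** A countable-valued approximation of the identity: any predicate composed
    with it is a countable union over the cells, which is what makes both open
    sets and Caratheodory compositions measurable. *)
Definition grid k x : 'rV[R]_n :=
  \row_i ((Num.floor (k.+1%:R * x 0 i))%:~R / k.+1%:R).

Lemma ball_rVP x e y : ball x e y <-> 0 < e /\ forall i, `|x 0 i - y 0 i| < e.
Proof.
split=> [[e0 h]|[e0 h]]; split=> // i; first exact: h.
by move=> j; rewrite ord1; exact: h.
Qed.

Lemma grid_dist k x i : `|x 0 i - grid k x 0 i| < k.+1%:R^-1.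
Proof.
rewrite mxE; have k0 : 0 < k.+1%:R :> R by rewrite ltr0n.
have /andP[h1 h2] := floor_itv (k.+1%:R * x 0 i).
set z := _%:~R in h1 *; rewrite intrD -/z in h2.
have -> : x 0 i - z / k.+1%:R = (k.+1%:R * x 0 i - z) / k.+1%:R.
  by rewrite mulrBl mulrAC mulfV ?mul1r// gt_eqF.
rewrite normrM ger0_norm ?subr_ge0// gtr0_norm ?invr_gt0//.
by rewrite -[ltRHS]mul1r ltr_pM2r ?invr_gt0// ltrBlDl.
Qed.

Lemma grid_cvg x : grid k x @[k --> \oo] --> x.
Proof.
apply/cvg_ballP => e e0; near=> k; apply/ball_rVP; split=> // i.
rewrite (lt_trans (grid_dist k x i))//.
by near: k; exact: (near_infty_natSinv_lt (PosNum e0)).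
Unshelve. all: by end_near. Qed.

Lemma measurable_grid_preimage d (T : measurableType d) (D : set T)
    (w : T -> 'rV[R]_n) (P : T -> 'rV[R]_n -> Prop) k :
    measurable D -> (forall i, measurable_fun D (fun t => w t 0 i)) ->
    (forall p, measurable (D `&` [set t | P t p])) ->
  measurable (D `&` [set t | P t (grid k (w t))]).
Proof.
move=> mD mw mP.
pose pt (z : 'rV[int]_n) : 'rV[R]_n := \row_i ((z 0 i)%:~R / k.+1%:R).
pose cell (z : 'rV[int]_n) :=
  \bigcap_(i in [set: 'I_n])
    (D `&` (fun t => w t 0 i) @^-1`
       [set r | Num.floor (k.+1%:R * r) = z 0 i]).
have -> : D `&` [set t | P t (grid k (w t))] =
    \bigcup_(z in [set: 'rV[int]_n]) ((D `&` [set t | P t (pt z)]) `&` cell z).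
  apply/seteqP; split => t /=.
    move=> [Dt Pt]; exists (\row_i Num.floor (k.+1%:R * w t 0 i)) => //.
    split; last by move=> i _; split => //=; rewrite mxE.
    split=> //=; congr (P t _): Pt; apply/rowP => i; by rewrite !mxE.
  move=> [z _ [[Dt Pt] cz]]; split=> //; congr (P t _): Pt.
  by apply/rowP => i; rewrite !mxE; have [_ /= ->] := cz i I.
apply: countable_bigcupT_measurable => [|z]; first exact: countableP.
apply: measurableI; first exact: mP.
apply: fin_bigcap_measurable => // i _.
apply: (mw i mD).
have -> : [set r : R | Num.floor (k.+1%:R * r) = z 0 i] =
    `[(z 0 i)%:~R / k.+1%:R, ((z 0 i) + 1)%:~R / k.+1%:R[%classic.
  have k0 : 0 < k.+1%:R :> R by rewrite ltr0n.
  apply/seteqP; split => r /=.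
    move=> <-; rewrite in_itv/= ler_pdivrMr// ltr_pdivlMr// mulrC.
    exact: floor_itv.
  rewrite in_itv/= ler_pdivrMr// ltr_pdivlMr// mulrC => h.
  by apply/eqP; rewrite floor_eq.
exact: measurable_itv.
Qed.

(** A point of U is detected by one of its grid approximations: the ball of
    radius 1/(k+1) about the k-th approximation contains the point, and lies in
    U once k is large. *)
Lemma open_measurable_rV (U : set 'rV[R]_n) : open U -> measurable U.
Proof.
move=> oU.
have -> : U = \bigcup_k ([set: 'rV[R]_n] `&`
    [set x | ball (grid k x) k.+1%:R^-1 `<=` U]).
  apply/seteqP; split => x.
    move=> Ux; have /nbhs_ballP[e /= e0 eU] := open_nbhs_nbhs (conj oU Ux).
    have e20 : 0 < e / 2 by rewrite divr_gt0.
    have [k _ hk] := near_infty_natSinv_lt (PosNum e20).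
    exists k => //; split => // y /ball_rVP[_ hy]; apply: eU.
    apply/ball_rVP; split => // i.
    have hx := grid_dist k x i; have := hk k (leqnn k) => /=.
    move: (hy i) hx; set g := grid k x 0 i; set q := _^-1.
    move: (x 0 i) (y 0 i) => a b h1 h2 h3.
    rewrite -(subrKA g); apply: le_lt_trans (ler_normD _ _) _; lra.
  move=> [k _ [_ /=]]; apply; apply/ball_rVP; split; first by rewrite invr_gt0.
  by move=> i; rewrite distrC; exact: grid_dist.
apply: bigcupT_measurable => k.
apply: (@measurable_grid_preimage _ _ setT id
   (fun _ p => ball p k.+1%:R^-1 `<=` U)) => //.
  exact: measurable_rV_coord.
move=> p; have [h|h] := pselect (ball p k.+1%:R^-1 `<=` U).
  rewrite (_ : [set _ | _] = setT) ?setIT//; by apply/seteqP; split.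
rewrite (_ : [set _ | _] = set0) ?setI0//; by apply/seteqP; split.
Qed.

(** Replacing w by its grid approximations makes the composition measurable,
    and continuity of Phi t recovers it in the limit. Continuity is only asked
    at the point w t, so that w = id gives functions continuous on an open set. *)
Lemma measurable_caratheodory d (T : measurableType d) (D : set T)
    (Phi : T -> 'rV[R]_n -> R) (w : T -> 'rV[R]_n) :
    measurable D -> (forall i, measurable_fun D (fun t => w t 0 i)) ->
    (forall p, measurable_fun D (Phi^~ p)) ->
    (forall t, D t -> {for w t, continuous (Phi t)}) ->
  measurable_fun D (fun t => Phi t (w t)).
Proof.
move=> mD mw mPhi cPhi.
apply: (@measurable_fun_cvg _ _ _ _ (fun k t => Phi t (grid k (w t)))).
  move=> k _ Y mY; apply: (@measurable_grid_preimage _ _ D w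
    (fun t p => Y (Phi t p))) => // p.
  exact: (mPhi p mD).
move=> t Dt; apply: (@cvg_comp _ _ _ (fun k => grid k (w t)) (Phi t)) (cPhi t Dt).
exact: grid_cvg.
Qed.

Lemma continuous_measurable_rV (D : set 'rV[R]_n) (f : 'rV[R]_n -> R) :
  measurable D -> (forall x, D x -> {for x, continuous f}) -> measurable_fun D f.
Proof.
move=> mD cf; apply: (@measurable_caratheodory _ _ D (fun=> f) id) => //.
by move=> i; apply: measurable_funS (measurable_rV_coord i).
Qed.

End measurability.

(** * Derivatives of compactly supported functions have zero mean *)

Section zero_mean_derivative.
Context (R : realType).

Definition supp_box n (M : R) (h : 'rV[R]_n -> R) :=
  forall x : 'rV[R]_n, (exists i, M < `|x 0 i|) -> h x = 0.

Definition box n (M : R) : set 'rV[R]_n := [set x : 'rV[R]_n | forall i, `|x 0 i| <= M].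

Lemma boxE n M : @box n M = [set x : 'rV[R]_n | forall i, `[- M, M]%classic (x 0 i)].
Proof.
by apply/seteqP; split => x h i; have := h i; rewrite /= in_itv/= ler_norml.
Qed.

Lemma compact_box n M : compact (@box n M).
Proof.
rewrite boxE; exact: (@rV_compact R n (fun=> `[- M, M]%classic) (fun=> @segment_compact R _ _)).
Qed.

Lemma measurable_box n M : measurable (@box n M).
Proof.
rewrite boxE.
have -> : [set x : 'rV[R]_n | forall i, `[- M, M]%classic (x 0 i)] =
    \bigcap_(i in [set: 'I_n]) ((fun x : 'rV[R]_n => x 0 i) @^-1` `[- M, M]%classic).
  by apply/seteqP; split => x /= h i => [_|]; exact: h.
apply: fin_bigcap_measurable => // i _; rewrite -[X in measurable X]setTI.
exact: measurable_rV_coord.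
Qed.

Lemma box_finite n M : (lebesgue_rV R n (@box n M) < +oo)%E.
Proof.
rewrite boxE (@lebesgue_rV_box R n (fun=> `[- M, M]%classic)); last by move=> i; exact: measurable_itv.
rewrite ltey_eq prode_fin_num// => i _.
rewrite lebesgue_measure_itv/=; by case: ifPn => // _; rewrite -EFinB.
Qed.

Lemma supp_box_restrict n M (h : 'rV[R]_n -> R) : supp_box M h -> h \_ (box M) = h.
Proof.
move=> hM; apply/funext => x; rewrite patchE; case: ifPn => // /negP xM.
rewrite hM//; apply: contrapT => /forallNP k; apply: xM; rewrite inE => i.
by rewrite leNgt; apply/negP; exact: k.
Qed.

Lemma continuous_supp_box_integrable n M (g : 'rV[R]_n -> R) :
  continuous g -> supp_box M g ->
  (lebesgue_rV R n).-integrable setT (EFin \o g).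
Proof.
move=> cg gM; rewrite -(supp_box_restrict gM) -restrict_EFin.
have mB := @measurable_box n M; apply/(integrable_mkcond _ mB).
apply: measurable_bounded_integrable.
- exact: measurable_box.
- exact: box_finite.
- exact: (continuous_measurable_rV mB (fun x _ => cg x)).
- have /compact_bounded := continuous_compact (continuous_subspaceT cg) (@compact_box n M).
  move=> [B [Br hB]]; exists B; split => // B' BB' x xM; apply: (hB _ BB').
  by exists x.
Qed.

Lemma supp_box_derive n M (h : 'rV[R]_n -> R) v :
  supp_box M h -> supp_box M (fun x => 'D_v h x).
Proof.
move=> hM x [l Ml]; rewrite (@near_eq_derive _ _ _ h (cst 0)) ?derive_cst//.
near=> y; apply: hM; exists l; near: y.
have : {for x, continuous (fun y : 'rV[R]_n => `|y 0 l|)}.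
  apply: (@continuous_comp _ _ _ (fun y : 'rV[R]_n => y 0 l) Num.Def.normr).
    exact: coord_continuous.
  exact: norm_continuous.
by move=> /(_ _ (lt_nbhsr Ml)).
Unshelve. all: by end_near. Qed.

(** A directional derivative only depends on the function along the line; this
    moves derivatives through the slices of the product structure. *)
Lemma derive_along_line (V V' : normedModType R) (f : V -> R) (g : V' -> R)
    (a v : V) (b w : V') :
  (forall t : R, f (t *: v + a) = g (t *: w + b)) ->
  'D_v f a = 'D_w g b /\ (derivable f a v -> derivable g b w).
Proof.
move=> fg; have fgab : f a = g b by have := fg 0; rewrite !scale0r !add0r.
have E : (fun t : R => t^-1 *: ((f \o shift a) (t *: v) - f a)) =
         (fun t : R => t^-1 *: ((g \o shift b) (t *: w) - g b)).
  by apply/funext => t; rewrite /= fg fgab.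
by rewrite /derive /derivable E.
Qed.

Lemma integral_derive1_eq0 M (f g : R -> R) :
  (forall x, derivable f x 1) -> continuous g -> (forall x, derive1 f x = g x) ->
  (forall x, M < `|x| -> f x = 0) -> (forall x, M < `|x| -> g x = 0) ->
  (\int[lebesgue_measure]_x (g x)%:E = 0)%E.
Proof.
(* B is a positive radius beyond which f vanishes, at the end points included. *)
move=> df cg fg fM gM; pose B := `|M| + 1.
have MB : M < B by rewrite /B (le_lt_trans (ler_norm M))// ltrDl.
have B0 : 0 < B by rewrite /B ltr_wpDl.
have cf : continuous f.
  by move=> x; apply: differentiable_continuous; apply/derivable1_diffP.
have -> : (fun x => (g x)%:E) = (fun x => (g x)%:E) \_ `[- B, B]%classic.
  apply/funext => x; rewrite patchE; case: ifPn => // /negP xB.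
  rewrite gM// ltNge; apply/negP => xM; apply: xB; rewrite inE/= in_itv/=.
  by rewrite -ler_norml (le_trans xM)// ltW.
rewrite -integral_mkcond (@continuous_FTC2 _ g f).
- rewrite !fM ?sube0// ?normrN gtr0_norm//.
- lra.
- exact: continuous_subspaceT.
- split; first by move=> x _; exact: df.
    by apply: cvg_at_right_filter; exact: cf.
  by apply: cvg_at_left_filter; exact: cf.
- by move=> x _.
Qed.

Lemma rV_cons_delta0 n t (x : R) (v : 'rV[R]_n) :
  t *: delta_mx 0 ord0 + rV_cons (x, v) = rV_cons (t + x, v).
Proof.
apply/rowP => i; have [j ->|->] := unliftP ord0 i.
  by rewrite 3!mxE !rV_consS/= mulr0 add0r.
by rewrite 3!mxE !rV_cons0/= mulr1.
Qed.

Lemma rV_cons_delta n t (x : R) (v : 'rV[R]_n) j :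
  t *: delta_mx 0 (lift ord0 j) + rV_cons (x, v) =
  rV_cons (x, t *: delta_mx 0 j + v).
Proof.
apply/rowP => i; have [k ->|->] := unliftP ord0 i.
  by rewrite 3!mxE !rV_consS/= !mxE (inj_eq lift_inj).
by rewrite 3!mxE !rV_cons0/= mulr0 add0r.
Qed.

Lemma continuous_rV_consr n (x : R) : continuous (fun v : 'rV[R]_n => rV_cons (x, v)).
Proof.
move=> v; have ? := nbhs_filter v; apply/cvg_ballP => e e0.
apply: (@filterS _ (nbhs v) (nbhs_filter v) _ _ _ (nbhsx_ballx v e e0)) => w.
move=> /ball_rVP[_ vw]; apply/ball_rVP; split=> // i.
have [k ->|->] := unliftP ord0 i; last by rewrite !rV_cons0 subrr normr0.
by rewrite !rV_consS/=; exact: vw.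
Qed.

Lemma continuous_rV_consl n (v : 'rV[R]_n) : continuous (fun x : R => rV_cons (x, v)).
Proof.
move=> x; apply/cvg_ballP => e e0.
apply: filterS (nbhsx_ballx x e e0) => y xy; apply/ball_rVP; split=> // i.
by have [k ->|->] := unliftP ord0 i; rewrite ?rV_consS ?rV_cons0//= subrr normr0.
Qed.

(** The Lebesgue measure in dimension n+1 is the image of a product measure
    under rV_cons. *)
Lemma lebesgue_rVS_Fubini n (g : 'rV[R]_n.+1 -> R) :
  (lebesgue_rV R n.+1).-integrable setT (EFin \o g) ->
  measurable_fun setT g ->
  (\int[lebesgue_rV R n.+1]_x (g x)%:E =
     \int[lebesgue_measure]_x \int[lebesgue_rV R n]_v (g (rV_cons (x, v)))%:E)%E /\
  (\int[lebesgue_rV R n.+1]_x (g x)%:E =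
     \int[lebesgue_rV R n]_v \int[lebesgue_measure]_x (g (rV_cons (x, v)))%:E)%E.
Proof.
move=> ig mg.
have mEg : measurable_fun setT (EFin \o g) by exact/measurable_EFinP.
pose mu := (@lebesgue_measure R \x lebesgue_rV R n)%E.
have mc := @measurable_rV_cons R n.
have E (f : 'rV[R]_n.+1 -> \bar R) :
    (\int[lebesgue_rV R n.+1]_x f x = \int[pushforward mu (@rV_cons R n)]_x f x)%E.
  by apply: eq_measure_integral.
have ic : mu.-integrable setT (fun p => (g (rV_cons p))%:E).
  apply/integrableP; split.
    by apply: (measurableT_comp mEg).
  have /integrableP[_] := ig; rewrite E ge0_integral_pushforward//.
  by apply: measurableT_comp.
have -> : (\int[lebesgue_rV R n.+1]_x (g x)%:E = \int[mu]_p (g (rV_cons p))%:E)%E.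
  by rewrite E integral_pushforward.
split.
  by rewrite -integral12_prod_meas1.
by rewrite -integral21_prod_meas1.
Qed.

(** By Fubini the integration can be done first along the i-th axis, where the
    fundamental theorem of calculus applies. Only the first axis is split off by
    the measure, so the other axes are reached by induction on the dimension. *)
Lemma integral_partial_eq0 n (h : 'rV[R]_n -> R) i M :
  (forall x, derivable h x (delta_mx 0 i)) ->
  continuous (fun x => 'D_(delta_mx 0 i) h x) -> supp_box M h ->
  (\int[lebesgue_rV R n]_x ('D_(delta_mx 0 i) h x)%:E = 0)%E.
Proof.
elim: n h i => [|n IH] h i; first by case: i.
move=> dh cDh hM; have DhM := supp_box_derive (delta_mx 0 i) hM.
have [F1 F2] := lebesgue_rVS_Fubini (continuous_supp_box_integrable cDh DhM)
  (continuous_measurable_rV measurableT (fun x _ => cDh x)).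
have [j ij|i0] := unliftP ord0 i.
  rewrite F1; apply: integral0_eq => x _.
  have Dx v : 'D_(delta_mx 0 i) h (rV_cons (x, v)) =
      'D_(delta_mx 0 j) (fun v => h (rV_cons (x, v))) v.
    by apply: (derive_along_line _).1 => t; rewrite ij rV_cons_delta.
  under eq_integral do rewrite Dx.
  apply: IH.
  - move=> v; apply: (derive_along_line _).2 (dh (rV_cons (x, v))) => t.
    by rewrite ij rV_cons_delta.
  - under eq_fun do rewrite -Dx.
    move=> v; apply: (@continuous_comp _ _ _ (fun v => rV_cons (x, v))
      (fun x => 'D_(delta_mx 0 i) h x)) => //.
    * exact: continuous_rV_consr.
    * exact: cDh.
  - move=> v [l Ml]; apply: hM; exists (lift ord0 l).
    by rewrite rV_consS.
rewrite F2; apply: integral0_eq => v _.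
apply: (@integral_derive1_eq0 M (fun x => h (rV_cons (x, v)))).
- move=> x; apply: (derive_along_line _).2 (dh (rV_cons (x, v))) => t.
  by rewrite i0 rV_cons_delta0 [_%:A]mulr1.
- move=> x; apply: (@continuous_comp _ _ _ (fun x => rV_cons (x, v))
      (fun x => 'D_(delta_mx 0 i) h x)) => //.
  * exact: continuous_rV_consl.
  * exact: cDh.
- move=> x; rewrite derive1E; apply/esym/(derive_along_line _).1 => t.
  by rewrite i0 rV_cons_delta0 [_%:A]mulr1.
- move=> x Mx; apply: hM; exists ord0; by rewrite rV_cons0.
- move=> x Mx; apply: DhM; exists ord0; by rewrite rV_cons0.
Qed.

End zero_mean_derivative.

(** * The inner product of square-integrable functions *)

Section L2_calculus.
Context (R : realType) (d : nat) (Om : set 'rV[R]_d).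
Hypothesis mOm : measurable Om.
Local Notation Rd := 'rV[R]_d.
Local Notation mu := (lebesgue_rV R d).
Local Notation L2 f := (Lp Om 2%:E f).
Implicit Types f g h c : Rd -> R.

Lemma ae_inS (P Q : Rd -> Prop) : (forall x, Om x -> P x -> Q x) ->
  ae_in Om P -> ae_in Om Q.
Proof.
by move=> PQ; rewrite /ae_in; apply: filterS => x Px Ox; exact: PQ (Px Ox).
Qed.

Lemma ae_inS2 (P Q S : Rd -> Prop) : (forall x, Om x -> P x -> Q x -> S x) ->
  ae_in Om P -> ae_in Om Q -> ae_in Om S.
Proof.
move=> PQ; rewrite /ae_in; apply: filterS2 => x Px Qx Ox.
exact: PQ (Px Ox) (Qx Ox).
Qed.

Lemma ae_inW (P : Rd -> Prop) : (forall x, Om x -> P x) -> ae_in Om P.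
Proof. by move=> h; apply: aeW. Qed.

Lemma LpnormE f :
  Lpnorm Om 2%:E f = ((\int[mu]_(x in Om) (f x ^+ 2)%:E) `^ 2^-1)%E.
Proof.
rewrite /Lpnorm unlock; congr (_ `^ _)%E; rewrite [RHS]integral_mkcond.
apply: eq_integral => x _; rewrite /= !patchE.
case: ifPn => _; first by rewrite powR_mulrn// real_normK ?num_real.
by rewrite (_ : point = 0 :> R)// normr0 powR0// pnatr_eq0.
Qed.

Lemma Lp2P f : L2 f <->
  measurable_fun Om f /\ mu.-integrable Om (EFin \o (fun x => f x ^+ 2)).
Proof.
rewrite /Lp LpnormE; split=> -[mf h]; split => //.
  apply/integrableP; split.
    by apply/measurable_EFinP; exact: measurable_funX.
  apply: le_lt_trans (lty_poweRy _ h); last by rewrite invr_eq0 pnatr_eq0.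
  by under eq_integral do rewrite /= ger0_norm ?sqr_ge0//.
by apply: poweR_lty; exact: integrable_lty.
Qed.

Lemma L2_measurable f : L2 f -> measurable_fun Om f.
Proof. by case. Qed.

Lemma ip_integrable f g : L2 f -> L2 g ->
  mu.-integrable Om (EFin \o (fun x => f x * g x)).
Proof.
move=> /Lp2P[mf if2] /Lp2P[mg ig2].
apply: (le_integrable mOm (g := EFin \o (fun x => f x ^+ 2 + g x ^+ 2))) => //.
- by apply/measurable_EFinP; exact: measurable_funM.
- move=> x _; rewrite /= lee_fin [leRHS]ger0_norm ?addr_ge0 ?sqr_ge0//.
  have := sqr_ge0 (f x + g x); have := sqr_ge0 (f x - g x).
  have := sqr_ge0 (f x); have := sqr_ge0 (g x).
  by rewrite ler_norml => *; apply/andP; split; nra.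
- by have := integrableD mOm if2 ig2.
Qed.

Lemma L2_le f g : measurable_fun Om f -> L2 g ->
  ae_in Om (fun x => `|f x| <= `|g x|) -> L2 f.
Proof.
move=> mf /Lp2P[mg ig] fg; apply/Lp2P; split => //.
have mS h : measurable_fun Om h -> measurable_fun Om (fun x => (h x ^+ 2)%:E).
  by move=> mh; apply/measurable_EFinP; exact: measurable_funX.
apply/integrableP; split; first exact: mS.
apply: le_lt_trans (integrable_lty mOm ig).
apply: ae_ge0_le_integral => //=.
- by apply/measurable_EFinP; apply: measurableT_comp => //; exact: measurable_funX.
- by move=> x _; rewrite lee_fin sqr_ge0.
- exact: mS.
- apply: ae_inS fg => x Ox h; rewrite lee_fin ger0_norm ?sqr_ge0//.
  by rewrite -[leLHS]real_normK ?num_real// -[leRHS]real_normK ?num_real// lerXn2r ?nnegrE//.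
Qed.

Lemma L2Z a f : L2 f -> L2 (fun x => a * f x).
Proof.
move=> /Lp2P[mf if2]; apply/Lp2P; split.
  by apply: measurable_funM.
have := integrableZl mOm (a ^+ 2) if2; congr (_.-integrable _ _).
by apply/funext => x; rewrite /= exprMn EFinM.
Qed.

Lemma L2D f g : L2 f -> L2 g -> L2 (fun x => f x + g x).
Proof.
move=> Lf Lg; have [mf if2] := (Lp2P f).1 Lf; have [mg ig2] := (Lp2P g).1 Lg.
apply/Lp2P; split; first exact: measurable_funD.
have h := integrableD mOm (integrableD mOm if2 ig2)
  (integrableZl mOm 2 (ip_integrable Lf Lg)).
move: h; congr (_.-integrable _ _).
by apply/funext => x; rewrite /= -EFinM -!EFinD; congr EFin; ring.
Qed.

Lemma L2N f : L2 f -> L2 (fun x => - f x).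
Proof.
by move=> /(L2Z (-1)); under eq_fun do rewrite mulN1r.
Qed.

Lemma L2B f g : L2 f -> L2 g -> L2 (fun x => f x - g x).
Proof. by move=> Lf Lg; apply: L2D => //; exact: L2N. Qed.

Lemma L20 : L2 (fun=> 0).
Proof.
apply/Lp2P; split; first exact: measurable_cst.
rewrite (_ : _ \o _ = cst 0%E); first exact: integrable0.
by apply/funext => x; rewrite /= expr0n.
Qed.

Lemma L2_sum (I : Type) (s : seq I) (F : I -> Rd -> R) :
  (forall i, L2 (F i)) -> L2 (fun x => \sum_(i <- s) F i x).
Proof.
move=> LF; elim: s => [|i s IH].
  by under eq_fun do rewrite big_nil; exact: L20.
by under eq_fun do rewrite big_cons; exact: L2D.
Qed.

Lemma L2_bounded B c f : measurable_fun Om c -> ae_in Om (fun x => `|c x| <= B) ->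
  L2 f -> L2 (fun x => c x * f x).
Proof.
move=> mc cB Lf; apply: L2_le (L2Z B Lf) _.
  by apply: measurable_funM => //; exact: L2_measurable Lf.
apply: ae_inS cB => x Ox h; rewrite !normrM ler_wpM2r//.
by rewrite (le_trans h)// ler_norm.
Qed.

Lemma L2normE f : L2norm Om f = Num.sqrt (ip Om f f).
Proof.
rewrite /L2norm LpnormE /ip /Rintegral.
under [in RHS]eq_integral do rewrite -expr2.
have : (0 <= \int[mu]_(x in Om) (f x ^+ 2)%:E)%E.
  by apply: integral_ge0 => x _; rewrite lee_fin sqr_ge0.
case: (\int[mu]_(x in Om) _)%E => [r|_|]//=.
- by rewrite lee_fin => r0; rewrite powR12_sqrt.
- by rewrite invr_eq0 pnatr_eq0/= sqrtr0.
Qed.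

Lemma ip_ge0 f g : (forall x, Om x -> 0 <= f x * g x) -> 0 <= ip Om f g.
Proof. by move=> h; apply: Rintegral_ge0. Qed.

Lemma ip_self_ge0 f : 0 <= ip Om f f.
Proof. by apply: ip_ge0 => x _; rewrite -expr2 sqr_ge0. Qed.

Lemma L2norm_ge0 f : 0 <= L2norm Om f.
Proof. by rewrite L2normE sqrtr_ge0. Qed.

Lemma sqr_L2norm f : L2norm Om f ^+ 2 = ip Om f f.
Proof. by rewrite L2normE sqr_sqrtr// ip_self_ge0. Qed.

Lemma ipC f g : ip Om f g = ip Om g f.
Proof. by apply: eq_Rintegral => x _; rewrite mulrC. Qed.

Lemma ip_linear a f g h : L2 f -> L2 g -> L2 h ->
  ip Om (fun x => a * f x + g x) h = a * ip Om f h + ip Om g h.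
Proof.
move=> Lf Lg Lh; have i1 := ip_integrable Lf Lh; have i2 := ip_integrable Lg Lh.
rewrite /ip -RintegralZl// -RintegralD//.
  by apply: eq_Rintegral => x _; rewrite mulrDl mulrA.
by have := integrableZl mOm a i1.
Qed.

Lemma ipD f g h : L2 f -> L2 g -> L2 h ->
  ip Om (fun x => f x + g x) h = ip Om f h + ip Om g h.
Proof.
move=> Lf Lg Lh; rewrite -[in RHS](mul1r (ip Om f h)) -ip_linear//.
by congr ip; apply/funext => x; rewrite mul1r.
Qed.

Lemma ipZ a f h : L2 f -> L2 h -> ip Om (fun x => a * f x) h = a * ip Om f h.
Proof.
move=> Lf Lh; have := ip_linear a Lf L20 Lh.
under [X in ip Om X h]eq_fun do rewrite addr0.
move=> ->; rewrite [X in _ + X](_ : _ = 0) ?addr0//.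
by rewrite /ip; under eq_Rintegral do rewrite mul0r; rewrite Rintegral_cst ?mul0r.
Qed.

Lemma ipB f g h : L2 f -> L2 g -> L2 h ->
  ip Om (fun x => f x - g x) h = ip Om f h - ip Om g h.
Proof.
move=> Lf Lg Lh; rewrite ipD//; last exact: L2N.
by rewrite -mulN1r -ipZ//; congr (_ + ip _ _ _); apply/funext => x; rewrite mulN1r.
Qed.

Lemma ip_ae f g f' g' : L2 f -> L2 g -> L2 f' -> L2 g' ->
  ae_in Om (fun x => f x * g x = f' x * g' x) -> ip Om f g = ip Om f' g'.
Proof.
move=> Lf Lg Lf' Lg' h; congr fine; apply: ae_eq_integral => //.
- by have /integrableP[] := ip_integrable Lf Lg.
- by have /integrableP[] := ip_integrable Lf' Lg'.
- by apply: ae_inS h => x Ox h /=; rewrite h.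
Qed.

(** The integral of the difference is that of its positive part, which agrees
    with it almost everywhere and is nonnegative everywhere. *)
Lemma ip_ae_le f g f' g' : L2 f -> L2 g -> L2 f' -> L2 g' ->
  ae_in Om (fun x => f x * g x <= f' x * g' x) -> ip Om f g <= ip Om f' g'.
Proof.
move=> Lf Lg Lf' Lg' h.
have i1 := ip_integrable Lf Lg; have i2 := ip_integrable Lf' Lg'.
have i3 : mu.-integrable Om (EFin \o (fun x => f' x * g' x - f x * g x)).
  by have := integrableB mOm i2 i1.
rewrite -subr_ge0 /ip -RintegralB//.
rewrite (_ : Rintegral _ _ _ =
    \int[mu]_(x in Om) Num.max (f' x * g' x - f x * g x) 0).
  by apply: Rintegral_ge0 => x _; rewrite le_max lexx orbT.
have mi : measurable_fun Om (fun x => f' x * g' x - f x * g x).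
  by apply/measurable_EFinP; have /integrableP[] := i3.
congr fine; apply: ae_eq_integral => //.
- exact/measurable_EFinP.
- by apply/measurable_EFinP; exact: measurable_maxr.
- apply: ae_inS h => x Ox h /=; congr EFin; apply/esym/max_idPl.
  by rewrite subr_ge0.
Qed.

Lemma CauchySchwarz_ip f g : L2 f -> L2 g ->
  `|ip Om f g| <= L2norm Om f * L2norm Om g.
Proof.
move=> Lf Lg.
(* The quadratic t |-> ip (t f - g) (t f - g) is nonnegative. *)
have quad t : 0 <= t ^+ 2 * ip Om f f - t *+ 2 * ip Om f g + ip Om g g.
  have := ip_self_ge0 (fun x => (- t) * f x + g x).
  have Lh := L2D (L2Z (- t) Lf) Lg.
  rewrite ip_linear// (ipC f) (ipC g) !ip_linear// (ipC g f).
  by move=> h; lra.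
rewrite -(@ler_pXn2r _ 2) ?nnegrE ?mulr_ge0 ?L2norm_ge0// exprMn !sqr_L2norm.
rewrite real_normK ?num_real//.
have [f0|f0] := eqVneq (ip Om f f) 0.
  rewrite f0 mul0r; have [->|p0] := eqVneq (ip Om f g) 0; first by rewrite expr0n.
  (* If ip f f vanishes, the quadratic is affine in t, and equals -1 at this t. *)
  have := quad ((ip Om g g + 1) / (ip Om f g *+ 2)).
  rewrite f0 mulr0 add0r.
  rewrite [X in - X](_ : _ = ip Om g g + 1); first lra.
  by rewrite -mulrnAl -!mulrA; field.
have fp : 0 < ip Om f f by rewrite lt_neqAle eq_sym f0 ip_self_ge0.
have := quad (ip Om f g / ip Om f f).
rewrite (_ : _ + _ = (ip Om f f * ip Om g g - ip Om f g ^+ 2) / ip Om f f).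
  by rewrite pmulr_lge0 ?invr_gt0// subr_ge0.
by field.
Qed.

Lemma ip_cvg0 (a : nat -> Rd -> R) f : (forall j, L2 (a j)) -> L2 f ->
  L2norm Om (a j) @[j --> \oo] --> 0 -> ip Om f (a j) @[j --> \oo] --> 0.
Proof.
move=> La Lf a0.
have b0 : L2norm Om f * L2norm Om (a j) @[j --> \oo] --> 0.
  by rewrite -(mulr0 (L2norm Om f)); apply: cvgM => //; exact: cvg_cst.
apply: (squeeze_cvgr (f := fun j => - (L2norm Om f * L2norm Om (a j)))
  (h := fun j => L2norm Om f * L2norm Om (a j))) => //.
  by near=> j; rewrite -ler_norml CauchySchwarz_ip.
by rewrite -oppr0; exact: cvgN.
Unshelve. all: by end_near. Qed.

Lemma L2norm_eq0 f : L2 f -> L2norm Om f = 0 -> ae_in Om (fun x => f x = 0).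
Proof.
move=> Lf; rewrite L2normE => /eqP; rewrite sqrtr_eq0 => f0.
have {}f0 : ip Om f f = 0 by apply/eqP; rewrite eq_le f0 ip_self_ge0.
have i := ip_integrable Lf Lf.
have /(ae_eq_integral_abs mu mOm) : measurable_fun Om (EFin \o (fun x => f x * f x)).
  by have /integrableP[] := i.
have -> : (\int[mu]_(x in Om) `|(EFin \o (fun x => (f x * f x)%R)) x| = 0)%E.
  transitivity (\int[mu]_(x in Om) (f x * f x)%:E)%E.
    by apply: eq_integral => x _; rewrite /= ger0_norm// -expr2 sqr_ge0.
  by rewrite -[LHS]fineK ?(integrable_fin_num mOm i)//; congr EFin.
move=> [h _]; have {}h := h erefl; apply: filterS h => x h Ox.
have := h Ox => /= -[] /eqP; by rewrite mulf_eq0 orbb => /eqP.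
Qed.

Lemma L2norm_ae0 f : L2 f -> ae_in Om (fun x => f x = 0) -> L2norm Om f = 0.
Proof.
move=> Lf f0; rewrite L2normE (@ip_ae f f (fun=> 0) f) ?L20//.
  by rewrite -[X in ip Om X](_ : (fun x : Rd => 0 * f x) = _);
    [rewrite ipZ// mul0r sqrtr0|apply/funext => x; rewrite mul0r].
  exact: L20.
by apply: ae_inS f0 => x Ox h; rewrite h// mul0r.
Qed.

Lemma L2normZ a f : L2 f -> L2norm Om (fun x => a * f x) = `|a| * L2norm Om f.
Proof.
move=> Lf; have LZ := L2Z a Lf.
apply/eqP; rewrite -(@eqrXn2 _ 2) ?mulr_ge0 ?L2norm_ge0// exprMn !sqr_L2norm.
by rewrite ipZ// ipC ipZ// mulrA real_normK ?num_real// expr2.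
Qed.

Lemma L2norm_le f g : L2 f -> L2 g -> ae_in Om (fun x => `|f x| <= `|g x|) ->
  L2norm Om f <= L2norm Om g.
Proof.
move=> Lf Lg fg; rewrite -(@ler_pXn2r _ 2) ?nnegrE ?L2norm_ge0// !sqr_L2norm.
apply: ip_ae_le => //; apply: ae_inS fg => x _ h.
by rewrite -!expr2 -[leLHS]real_normK ?num_real// -[leRHS]real_normK ?num_real// lerXn2r ?nnegrE.
Qed.

End L2_calculus.

(** * Euclidean geometry and square-integrable vector fields *)

Section euclidean_norm.
Context (R : realType).

Lemma fnorm_ge0 m n (A : 'M[R]_(m, n)) : 0 <= fnorm A.
Proof. exact: sqrtr_ge0. Qed.

Lemma normr_le_fnorm m n (A : 'M[R]_(m, n)) i j : `|A i j| <= fnorm A.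
Proof.
rewrite -(@ler_pXn2r _ 2) ?nnegrE ?fnorm_ge0// real_normK ?num_real//.
rewrite sqr_sqrtr; last by do 2!apply: sumr_ge0 => ? _; exact: sqr_ge0.
rewrite (bigD1 i)//= (bigD1 j)//= -addrA lerDl addr_ge0//.
  by apply: sumr_ge0 => ? _; exact: sqr_ge0.
by do 2!apply: sumr_ge0 => ? _; exact: sqr_ge0.
Qed.

Context (n : nat).
Implicit Types p q r : 'rV[R]_n.

Lemma sqr_fnorm p : fnorm p ^+ 2 = dot p p.
Proof.
rewrite sqr_sqrtr; last by do 2!apply: sumr_ge0 => ? _; exact: sqr_ge0.
by rewrite big_ord1; apply: eq_bigr => i _; rewrite expr2.
Qed.

Lemma dotC p q : dot p q = dot q p.
Proof. by apply: eq_bigr => i _; rewrite mulrC. Qed.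

Lemma dotDr p q r : dot p (q + r) = dot p q + dot p r.
Proof. by rewrite -big_split; apply: eq_bigr => i _; rewrite mxE mulrDr. Qed.

Lemma dotZr a p q : dot p (a *: q) = a * dot p q.
Proof. by rewrite mulr_sumr; apply: eq_bigr => i _; rewrite mxE mulrCA. Qed.

Lemma dotNr p q : dot p (- q) = - dot p q.
Proof. by rewrite -scaleN1r dotZr mulN1r. Qed.

Lemma dotBr p q r : dot p (q - r) = dot p q - dot p r.
Proof. by rewrite dotDr dotNr. Qed.

Lemma dotDl p q r : dot (p + q) r = dot p r + dot q r.
Proof. by rewrite dotC dotDr !(dotC r). Qed.

Lemma dotZl a p q : dot (a *: p) q = a * dot p q.
Proof. by rewrite dotC dotZr dotC. Qed.

Lemma dotBl p q r : dot (p - q) r = dot p r - dot q r.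
Proof. by rewrite dotC dotBr !(dotC r). Qed.

Lemma dotNl p q : dot (- p) q = - dot p q.
Proof. by rewrite dotC dotNr dotC. Qed.

Lemma dot0r p : dot p 0 = 0.
Proof. by rewrite -[X in dot p X](scale0r 0) dotZr mul0r. Qed.

Lemma dot_self_ge0 p : 0 <= dot p p.
Proof. by rewrite -sqr_fnorm sqr_ge0. Qed.

Lemma fnorm_eq0 p : fnorm p = 0 -> p = 0.
Proof.
move=> p0; apply/rowP => i; rewrite mxE; apply/eqP.
by rewrite -normr_le0 -p0 normr_le_fnorm.
Qed.

Lemma fnorm0 : fnorm (0 : 'rV[R]_n) = 0.
Proof.
by apply/eqP; rewrite -sqrf_eq0 sqr_fnorm dot0r.
Qed.

Lemma fnormZ a p : fnorm (a *: p) = `|a| * fnorm p.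
Proof.
apply/eqP; rewrite -(@eqrXn2 _ 2) ?mulr_ge0 ?fnorm_ge0//.
by rewrite exprMn real_normK ?num_real// !sqr_fnorm dotZl dotZr mulrA expr2.
Qed.

Lemma fnormN p : fnorm (- p) = fnorm p.
Proof. by rewrite -scaleN1r fnormZ normrN1 mul1r. Qed.

Lemma fnormB p q : fnorm (p - q) = fnorm (q - p).
Proof. by rewrite -fnormN opprB. Qed.

Lemma CauchySchwarz_dot p q : `|dot p q| <= fnorm p * fnorm q.
Proof.
rewrite -(@ler_pXn2r _ 2) ?nnegrE ?mulr_ge0 ?fnorm_ge0// exprMn !sqr_fnorm.
rewrite real_normK ?num_real//.
have [p0|p0] := eqVneq (fnorm p) 0.
  by rewrite (fnorm_eq0 p0) dotC dot0r expr0n/= mulr_ge0// dot_self_ge0.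
have pp : 0 < dot p p by rewrite -sqr_fnorm exprn_gt0// lt_neqAle eq_sym p0 fnorm_ge0.
have := dot_self_ge0 (dot p p *: q - dot p q *: p).
rewrite dotBl !dotBr !dotZl !dotZr (dotC q p).
rewrite (_ : _ - _ = dot p p * (dot p p * dot q q - dot p q ^+ 2)); last by ring.
by rewrite pmulr_rge0// subr_ge0.
Qed.

Lemma fnormD p q : fnorm (p + q) <= fnorm p + fnorm q.
Proof.
rewrite -(@ler_pXn2r _ 2) ?nnegrE ?addr_ge0 ?fnorm_ge0//.
rewrite sqrrD !sqr_fnorm dotDl !dotDr (dotC q p).
have := le_trans (ler_norm _) (CauchySchwarz_dot p q); rewrite mulr2n; lra.
Qed.

Lemma dot_delta p i : dot p (delta_mx 0 i) = p 0 i.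
Proof.
rewrite /dot (bigD1 i)//= [delta_mx _ _ _ _]mxE !eqxx mulr1 big1 ?addr0// => j /negPf ji.
by rewrite mxE ji andbF mulr0.
Qed.

Lemma fnorm_delta (i : 'I_n) : fnorm (delta_mx 0 i : 'rV[R]_n) = 1.
Proof.
apply/eqP; rewrite -(@eqrXn2 _ 2) ?fnorm_ge0// sqr_fnorm expr1n.
by rewrite dot_delta mxE !eqxx.
Qed.

Lemma fnorm_le_sum p : fnorm p <= \sum_i `|p 0 i|.
Proof.
rewrite -(@ler_pXn2r _ 2) ?nnegrE ?fnorm_ge0 ?sumr_ge0//.
rewrite sqr_fnorm expr2 mulr_suml; apply: ler_sum => i _.
rewrite (le_trans (ler_norm _))// normrM ler_wpM2l// (bigD1 i)//= lerDl.
exact: sumr_ge0.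
Qed.

End euclidean_norm.

Section vector_L2.
Context (R : realType) (d : nat) (Om : set 'rV[R]_d).
Hypothesis mOm : measurable Om.
Local Notation Rd := 'rV[R]_d.
Local Notation mu := (lebesgue_rV R d).
Local Notation L2 f := (Lp Om 2%:E f).
Local Notation VL2 g := (Lp_mx Om 2%:E g).
Implicit Types (g : Rd -> Rd).

Lemma measurable_dot g g' : (forall i, measurable_fun Om (fun x => g x 0 i)) ->
  (forall i, measurable_fun Om (fun x => g' x 0 i)) ->
  measurable_fun Om (fun x => dot (g x) (g' x)).
Proof.
by move=> mg mg'; apply: measurable_sum => i; exact: measurable_funM.
Qed.

Lemma measurable_fnorm g : (forall i, measurable_fun Om (fun x => g x 0 i)) ->
  measurable_fun Om (fun x => fnorm (g x)).
Proof.
move=> mg.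
have -> : (fun x => fnorm (g x)) = (fun x => Num.sqrt (dot (g x) (g x))).
  by apply/funext => x; rewrite -sqr_fnorm sqrtr_sqr ger0_norm// fnorm_ge0.
have ms : measurable_fun setT (@Num.sqrt R).
  by apply: continuous_measurable_fun => x; exact: sqrt_continuous.
exact: (measurableT_comp ms (measurable_dot mg mg)).
Qed.

Lemma Lp_mx2P g : VL2 g <-> forall i, L2 (fun x => g x 0 i).
Proof.
split=> [[mg gy] i|Lg].
  have mn := measurable_fnorm (mg 0).
  apply: (@L2_le _ _ _ mOm _ (fun x => fnorm (g x))) => //.
  apply: ae_inW => x _; rewrite [leRHS]ger0_norm ?fnorm_ge0//.
  exact: normr_le_fnorm.
split=> [i j|]; first by rewrite (ord1 i); exact: (Lg j).1.
suff [] : L2 (fun x => fnorm (g x)) by [].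
apply: (@L2_le _ _ _ mOm _ (fun x => \sum_i `|g x 0 i|)).
- by apply: measurable_fnorm => i; exact: (Lg i).1.
- apply: L2_sum => // i; apply: (L2_le mOm _ (Lg i)).
    by apply: measurableT_comp => //; exact: (Lg i).1.
  by apply: ae_inW => x _; rewrite normr_id.
- apply: ae_inW => x _; rewrite !ger0_norm ?fnorm_ge0 ?sumr_ge0//.
  exact: fnorm_le_sum.
Qed.

Lemma L2_fnorm g : VL2 g -> L2 (fun x => fnorm (g x)).
Proof. by move=> [mg gy]; split => //; exact: measurable_fnorm (mg 0). Qed.

Lemma L2_coord g i : VL2 g -> L2 (fun x => g x 0 i).
Proof. by move=> /Lp_mx2P. Qed.

Lemma L2_dot B g g' : (forall i, measurable_fun Om (fun x => g x 0 i)) ->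
  ae_in Om (fun x => fnorm (g x) <= B) -> VL2 g' ->
  L2 (fun x => dot (g x) (g' x)).
Proof.
move=> mg gB Lg'; apply: L2_sum => // i; apply: (L2_bounded mOm (B := B)) => //.
  by apply: ae_inS gB => x _; apply: le_trans; exact: normr_le_fnorm.
exact: L2_coord.
Qed.

Lemma L2norm_mxE g : L2norm_mx Om g = L2norm Om (fun x => fnorm (g x)).
Proof. by []. Qed.

Lemma vipE g g' : VL2 g -> VL2 g' ->
  vip Om g g' = \sum_i ip Om (fun x => g x 0 i) (fun x => g' x 0 i).
Proof.
move=> Lg Lg'; rewrite /vip /dot.
have h (s : seq 'I_d) : mu.-integrable Om (EFin \o (fun x => \sum_(i <- s) g x 0 i * g' x 0 i)) /\
    \int[mu]_(x in Om) (\sum_(i <- s) g x 0 i * g' x 0 i) =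
    \sum_(i <- s) ip Om (fun x => g x 0 i) (fun x => g' x 0 i).
  elim: s => [|i s [IH1 IH2]].
    under eq_fun do rewrite big_nil; split.
      by rewrite (_ : _ \o _ = cst 0%E)//; exact: integrable0.
    by rewrite big_nil Rintegral_cst ?mul0r.
  have I := ip_integrable mOm (L2_coord i Lg) (L2_coord i Lg').
  under eq_fun do rewrite big_cons; split; first by have := integrableD mOm I IH1.
  by rewrite RintegralD// big_cons IH2.
exact: (h _).2.
Qed.

Lemma L2norm_coord_le g i : VL2 g -> L2norm Om (fun x => g x 0 i) <= L2norm_mx Om g.
Proof.
move=> Lg; have Li := L2_coord i Lg; have Ln := L2_fnorm Lg.
apply: L2norm_le => //; apply: ae_inW => x _; rewrite [leRHS]ger0_norm ?fnorm_ge0//.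
exact: normr_le_fnorm.
Qed.

Lemma L2norm_mx_le g : VL2 g -> L2norm_mx Om g <= \sum_i L2norm Om (fun x => g x 0 i).
Proof.
move=> Lg; have Ln := L2_fnorm Lg.
rewrite L2norm_mxE -(@ler_pXn2r _ 2) ?nnegrE ?L2norm_ge0 ?sumr_ge0//; last first.
  by move=> i _; exact: L2norm_ge0.
have -> : L2norm Om (fun x => fnorm (g x)) ^+ 2 = \sum_i L2norm Om (fun x => g x 0 i) ^+ 2.
  rewrite sqr_L2norm; under eq_bigr do rewrite sqr_L2norm.
  rewrite -vipE//; apply: eq_Rintegral => x _.
  by rewrite -expr2 sqr_fnorm.
rewrite [leRHS]expr2 mulr_suml; apply: ler_sum => i _.
rewrite expr2 ler_wpM2l ?L2norm_ge0// (bigD1 i)//= lerDl.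
by apply: sumr_ge0 => j _; exact: L2norm_ge0.
Qed.

Lemma L2norm_linear a (f f' : Rd -> R) : L2 f -> L2 f' ->
  L2norm Om (fun x => a * f x + f' x) <= `|a| * L2norm Om f + L2norm Om f'.
Proof.
move=> Lf Lf'; have Lh := L2D mOm (L2Z mOm a Lf) Lf'.
rewrite -(@ler_pXn2r _ 2) ?nnegrE ?addr_ge0 ?mulr_ge0 ?L2norm_ge0//.
rewrite sqr_L2norm ip_linear// (ipC _ f) (ipC _ f') !ip_linear// (ipC _ f' f).
rewrite sqrrD exprMn real_normK ?num_real// !sqr_L2norm.
have : a * ip Om f f' <= `|a| * (L2norm Om f * L2norm Om f').
  by rewrite (le_trans (ler_norm _))// normrM ler_wpM2l// CauchySchwarz_ip.
rewrite mulrA mulr2n; lra.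
Qed.

End vector_L2.

(** * Test functions, and uniqueness of the weak gradient *)

Section test_functions.
Context (R : realType) (d : nat) (Om : set 'rV[R]_d).
Hypotheses (oOm : open Om) (bOm : bounded_set Om).
Local Notation Rd := 'rV[R]_d.
Local Notation mu := (lebesgue_rV R d).
Local Notation L2 f := (Lp Om 2%:E f).
Local Notation VL2 g := (Lp_mx Om 2%:E g).
Local Notation D i f := (fun x : Rd => 'D_(delta_mx 0 i) f x).
Implicit Types (f phi psi : Rd -> R).

Let mOm : measurable Om := open_measurable_rV oOm.

Lemma bounded_set_box : exists M, Om `<=` box M.
Proof.
have [B [_ hB]] := bOm; exists (`|B| + 2) => x Ox i.
have := hB (`|B| + 1) (le_lt_trans (ler_norm B) _) x Ox.
rewrite ltrDl => /(_ ltr01) xB.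
have : ball (0 : Rd) (`|B| + 2) x.
  by rewrite mx_norm_ball /ball_/= sub0r normrN (le_lt_trans xB)//; lra.
by move=> /ball_rVP[_ /(_ i)]; rewrite mxE sub0r normrN => /ltW.
Qed.

Lemma supp_box_L2 M f : continuous f -> supp_box M f -> L2 f.
Proof.
move=> cf fM; apply/(Lp2P mOm); split.
  by apply: continuous_measurable_rV => // x _; exact: cf.
apply: (@integrableS _ _ _ _ setT) => //.
apply: (@continuous_supp_box_integrable _ _ M).
  by move=> x; apply: continuousM; exact: cf.
by move=> x xM; rewrite fM// expr0n.
Qed.

Lemma test_fun_eq0 phi x : test_fun Om phi -> ~ Om x -> phi x = 0.
Proof.
move=> [_ _ sO] nO; apply: contrapT => px; apply: nO; apply: sO.
by apply: subset_closure => /=; apply/eqP.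
Qed.

Lemma test_fun_derive_eq0 phi v x : test_fun Om phi -> ~ Om x -> 'D_v phi x = 0.
Proof.
move=> [_ _ sO] nO; rewrite (@near_eq_derive _ _ _ phi (cst 0)) ?derive_cst//.
have : nbhs x (~` closure [set x | phi x != 0]).
  apply: open_nbhs_nbhs; split; last by move=> /sO.
  by apply: closed_openC; exact: closed_closure.
apply: filterS => y ny; apply: contrapT => /eqP py; apply: ny.
exact: subset_closure.
Qed.

Lemma test_fun_supp_box M phi : Om `<=` box M -> test_fun Om phi -> supp_box M phi.
Proof.
move=> OM tphi x [i Mi]; apply: test_fun_eq0 tphi _ => /OM /(_ i).
by rewrite leNgt Mi.
Qed.

Lemma test_fun_continuous phi : test_fun Om phi -> continuous phi.
Proof.
by move=> [s _ _] x; apply: differentiable_continuous; exact: s [::] x.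
Qed.

Lemma test_fun_derive_continuous phi i : test_fun Om phi -> continuous (D i phi).
Proof.
move=> [s _ _] x; apply: differentiable_continuous.
exact: s [:: delta_mx 0 i] x.
Qed.

Lemma test_fun_L2 phi : test_fun Om phi -> L2 phi.
Proof.
move=> t; have [M OM] := bounded_set_box.
exact: supp_box_L2 (test_fun_continuous t) (test_fun_supp_box OM t).
Qed.

Lemma test_fun_derive_L2 phi i : test_fun Om phi -> L2 (D i phi).
Proof.
move=> t; have [M OM] := bounded_set_box.
apply: supp_box_L2 (test_fun_derive_continuous t) _.
exact: supp_box_derive (test_fun_supp_box OM t).
Qed.

Lemma test_fun_derive2_L2 phi i : test_fun Om phi -> L2 (D i (D i phi)).
Proof.
move=> t; have [M OM] := bounded_set_box.
apply: (@supp_box_L2 M); last first.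
  by apply/supp_box_derive/supp_box_derive; exact: test_fun_supp_box OM t.
have [s _ _] := t => x; apply: differentiable_continuous.
exact: s [:: delta_mx 0 i; delta_mx 0 i] x.
Qed.

(** Integration by parts: the product of D_i phi and psi is continuously
    differentiable with compact support, so its i-th derivative has zero mean. *)
Lemma ip_derive_test_fun phi psi i : test_fun Om phi -> test_fun Om psi ->
  ip Om (D i phi) (D i psi) = - ip Om (D i (D i phi)) psi.
Proof.
move=> t t'; have [M OM] := bounded_set_box.
pose h x := D i phi x * psi x.
have d1 x : derivable (D i phi) x (delta_mx 0 i).
  by apply: diff_derivable; have [s _ _] := t; exact: s [:: delta_mx 0 i] x.
have d2 x : derivable psi x (delta_mx 0 i).
  by apply: diff_derivable; have [s _ _] := t'; exact: s [::] x.
have Dh x : 'D_(delta_mx 0 i) h x = D i phi x * D i psi x + D i (D i phi) x * psi x.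
  by rewrite deriveM// /GRing.scale/=; congr (_ + _); rewrite mulrC.
have hM : supp_box M h.
  by move=> x xM; rewrite /h (test_fun_supp_box OM t' xM) mulr0.
have cDh : continuous (fun x => 'D_(delta_mx 0 i) h x).
  under eq_fun do rewrite Dh.
  rewrite -[X in continuous X]/(D i phi * D i psi + D i (D i phi) * psi).
  move=> x; apply: continuousD; apply: continuousM.
  - exact: (test_fun_derive_continuous t).
  - exact: (test_fun_derive_continuous t').
  - apply: differentiable_continuous; have [s _ _] := t.
    exact: s [:: delta_mx 0 i; delta_mx 0 i] x.
  - exact: (test_fun_continuous t').
have := integral_partial_eq0 (fun x => derivableM (d1 x) (d2 x)) cDh hM.
have -> : (fun x => ('D_(delta_mx 0 i) h x)%:E) =
    (fun x => ('D_(delta_mx 0 i) h x)%:E) \_ Om.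
  apply/funext => x; rewrite patchE; case: ifPn => //; rewrite notin_setE => nO.
  by rewrite Dh (test_fun_derive_eq0 _ t' nO) (test_fun_eq0 t' nO) !mulr0 addr0.
rewrite -integral_mkcond => /(congr1 fine); rewrite -/(Rintegral _ _ _)/=.
under eq_Rintegral do rewrite Dh.
rewrite RintegralD//.
- by move/eqP; rewrite addr_eq0 => /eqP.
- by apply: ip_integrable => //; exact: test_fun_derive_L2.
- apply: ip_integrable => //; first exact: test_fun_derive2_L2.
  exact: test_fun_L2.
Qed.

Lemma Lpnorm_L2norm f : L2 f -> Lpnorm Om 2%:E f = (L2norm Om f)%:E.
Proof.
by move=> [_ fy]; rewrite /L2norm fineK// ge0_fin_numE// /Lpnorm Lnorm_ge0.
Qed.

Lemma Lpnorm_cvg0P (a : nat -> Rd -> R) : (forall j, L2 (a j)) ->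
  Lpnorm Om 2%:E (a j) @[j --> \oo] --> 0%E <->
  L2norm Om (a j) @[j --> \oo] --> 0.
Proof.
move=> La; under eq_fun do rewrite Lpnorm_L2norm//.
split=> h; first exact: (fine_cvg (f := fun j => (L2norm Om (a j))%:E) h).
by apply: cvg_EFin => //; exact: nearW.
Qed.

Lemma ip_cvg (a : nat -> Rd -> R) f b : (forall j, L2 (a j)) -> L2 f -> L2 b ->
  L2norm Om (a j \- b) @[j --> \oo] --> 0 ->
  ip Om f (a j) @[j --> \oo] --> ip Om f b.
Proof.
move=> La Lf Lb ab; apply/subr_cvg0.
have Lab j : L2 (a j \- b) by exact: L2B.
have := ip_cvg0 mOm Lab Lf ab.
by under eq_fun do rewrite ipC ipB// ipC [in X in _ - X]ipC.
Qed.

Lemma L2norm_cvg0_linear (a b c : nat -> Rd -> R) r :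
  (forall j, L2 (a j)) -> (forall j, L2 (b j)) ->
  (forall j x, c j x = r * a j x + b j x) ->
  L2norm Om (a j) @[j --> \oo] --> 0 -> L2norm Om (b j) @[j --> \oo] --> 0 ->
  L2norm Om (c j) @[j --> \oo] --> 0.
Proof.
move=> La Lb cE a0 b0.
apply: (squeeze_cvgr (f := fun=> 0)
  (h := fun j => `|r| * L2norm Om (a j) + L2norm Om (b j))).
- near=> j; rewrite L2norm_ge0/=.
  by rewrite (_ : c j = (fun x => r * a j x + b j x)) ?L2norm_linear//; exact/funext.
- exact: cvg_cst.
- rewrite -[X in _ --> X](addr0 0) -[X in _ --> X + _](mulr0 `|r|).
  by apply: cvgD => //; apply: cvgM => //; exact: cvg_cst.
Unshelve. all: by end_near. Qed.

Lemma L2norm_mx_cvg0P (g : nat -> Rd -> Rd) : (forall j, VL2 (g j)) ->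
  Lpnorm_mx Om 2%:E (g j) @[j --> \oo] --> 0%E <->
  forall i, L2norm Om (fun x => g j x 0 i) @[j --> \oo] --> 0.
Proof.
move=> Lg; rewrite /Lpnorm_mx Lpnorm_cvg0P; last by move=> j; exact: L2_fnorm.
split=> [h i|h].
  apply: (squeeze_cvgr (f := fun=> 0) (h := fun j => L2norm_mx Om (g j))) => //.
    by near=> j; rewrite L2norm_ge0/= L2norm_coord_le.
  exact: cvg_cst.
apply: (squeeze_cvgr (f := fun=> 0)
    (h := fun j => \sum_i L2norm Om (fun x => g j x 0 i))) => //.
- by near=> j; rewrite L2norm_ge0/= -L2norm_mxE L2norm_mx_le.
- exact: cvg_cst.
- have := @cvg_big R 'I_d +%R 0 xpredT (@add_continuous R) nat \oo%classic
    (index_enum _) (fun i j => L2norm Om (fun x => g j x 0 i)) (fun=> 0) _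
    (fun i _ => h i).
  by rewrite big1//; apply; exact: eventually_filter.
Unshelve. all: by end_near. Qed.

Lemma VL2B (g g' : Rd -> Rd) : VL2 g -> VL2 g' -> VL2 (g \- g').
Proof.
move=> /(Lp_mx2P mOm) Lg /(Lp_mx2P mOm) Lg'; apply/(Lp_mx2P mOm) => i.
by under eq_fun do rewrite !mxE; exact: L2B.
Qed.

Lemma test_fun_grad_L2 phi : test_fun Om phi -> VL2 (grad phi).
Proof.
move=> t; apply/(Lp_mx2P mOm) => i; under eq_fun do rewrite mxE.
exact: test_fun_derive_L2.
Qed.

(** Convergence to v in H^1, expressed on each component by real norms. *)
Definition H10_approx (v : sobolev R d) (phi : nat -> Rd -> R) :=
  [/\ forall j, test_fun Om (phi j),
      L2norm Om (phi j \- v.1) @[j --> \oo] --> 0 &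
      forall i, L2norm Om (fun x => D i (phi j) x - v.2 x 0 i) @[j --> \oo] --> 0].

Lemma H10P (v : sobolev R d) : H10 Om v <->
  [/\ L2 v.1, VL2 v.2 & exists phi_ : nat -> Rd -> R, H10_approx v phi_].
Proof.
split=> -[L1 L2' [phi [t c1 c2]]]; split => //; exists phi; split => //.
- by apply: (Lpnorm_cvg0P _).1 c1 => j; apply: L2B => //; exact: test_fun_L2.
- move=> i; have LG j : VL2 (grad (phi j) \- v.2).
    by apply: VL2B => //; exact: test_fun_grad_L2.
  by have := (L2norm_mx_cvg0P LG).1 c2 i;
    under eq_fun do under eq_fun do rewrite !mxE.
- by apply: (Lpnorm_cvg0P _).2 c1 => j; apply: L2B => //; exact: test_fun_L2.
- have LG j : VL2 (grad (phi j) \- v.2).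
    by apply: VL2B => //; exact: test_fun_grad_L2.
  apply: (L2norm_mx_cvg0P LG).2 => i; have := c2 i.
  by under [in X in _ -> X]eq_fun do under eq_fun do rewrite !mxE.
Qed.

(** The weak gradient g = v.2 is the limit of the gradients of test functions
    phi_j which tend to 0. Integrating by parts, each D_i phi_l is orthogonal to
    g_i, since its product with D_i phi_j is that of - D_i D_i phi_l with phi_j,
    which tends to 0 as j grows. Letting l grow, g_i is orthogonal to itself. *)
Lemma H10_grad_eq0 (v : sobolev R d) : H10 Om v -> (forall x, Om x -> v.1 x = 0) ->
  ae_in Om (fun x => v.2 x = 0).
Proof.
move=> /H10P[Lv Lg [phi [t c1 c2]]] v0.
have phi0 : L2norm Om (phi j) @[j --> \oo] --> 0.
  rewrite (_ : (fun j => L2norm Om (phi j)) = (fun j => L2norm Om (phi j \- v.1)))//.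
  apply/funext => j; rewrite !L2normE; congr Num.sqrt.
  by apply: eq_Rintegral => x /set_mem Ox /=; rewrite v0// subr0.
have ortho l i : ip Om (D i (phi l)) (fun x => v.2 x 0 i) = 0.
  apply/(@cvg_unique _ _ (ip Om (D i (phi l)) (D i (phi j)) @[j --> \oo])) => //.
    apply: ip_cvg.
    - by move=> j; exact: test_fun_derive_L2.
    - exact: test_fun_derive_L2.
    - exact: L2_coord.
    - exact: c2.
  rewrite (_ : (fun j => ip Om (D i (phi l)) (D i (phi j))) =
      (fun j => - ip Om (D i (D i (phi l))) (phi j)));
    last by apply/funext => j; rewrite ip_derive_test_fun.
  rewrite /= -[X in _ --> X]oppr0; apply: cvgN; apply: ip_cvg0 => // [j|].
    exact: test_fun_L2.
  exact: test_fun_derive2_L2.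
have gi0 i : ae_in Om (fun x => v.2 x 0 i = 0).
  have Lgi := L2_coord mOm i Lg.
  apply: L2norm_eq0 => //; rewrite L2normE.
  suff -> : ip Om (fun x => v.2 x 0 i) (fun x => v.2 x 0 i) = 0 by rewrite sqrtr0.
  apply/(@cvg_unique _ _ (ip Om (fun x => v.2 x 0 i) (D i (phi j)) @[j --> \oo])) => //.
    apply: ip_cvg => //; first by move=> j; exact: test_fun_derive_L2.
    exact: c2.
  rewrite (_ : (fun j => ip Om (fun x => v.2 x 0 i) (D i (phi j))) = (fun=> 0)); first exact: cvg_cst.
  by apply/funext => j; rewrite ipC ortho.
have : ae_in Om (fun x => forall i, v.2 x 0 i = 0).
  suff : ae_in Om (fun x => forall i, i \in enum 'I_d -> v.2 x 0 i = 0).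
    by apply: ae_inS => x _ h i; apply: h; rewrite mem_enum.
  elim: (enum _) => [|i s IH]; first by apply: ae_inW.
  apply: ae_inS2 (gi0 i) IH => x _ h1 h2 j; rewrite inE => /orP[/eqP ->//|].
  exact: h2.
by apply: ae_inS => x _ h; apply/rowP => i; rewrite h mxE.
Qed.

(** Iterated derivatives are linear on smooth functions, and the support of a
    combination lies in the union of the supports. *)
Lemma test_fun_linear a phi psi : test_fun Om phi -> test_fun Om psi ->
  test_fun Om (fun x => a * phi x + psi x).
Proof.
move=> [s1 k1 o1] [s2 k2 o2].
have fold_linear s : foldr (fun w (h : Rd -> R) => 'D_w h)
      (fun x => a * phi x + psi x) s =
    a \*: foldr (fun w (h : Rd -> R) => 'D_w h) phi s +
    foldr (fun w (h : Rd -> R) => 'D_w h) psi s.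
  elim: s => //= w s ->; apply/funext => x.
  rewrite deriveD; [|exact: derivableZ (diff_derivable (s1 s x))|
    exact: diff_derivable (s2 s x)].
  by rewrite deriveZ//; exact: diff_derivable (s1 s x).
have sub : closure [set x | a * phi x + psi x != 0] `<=`
    closure [set x | phi x != 0] `|` closure [set x | psi x != 0].
  rewrite -closureU; apply: closure_subset => x /=; apply: contraPP => /not_orP[].
  by move=> /negP/negPn/eqP -> /negP/negPn/eqP ->; rewrite mulr0 addr0 eqxx.
split.
- move=> s x; rewrite fold_linear; apply: differentiableD; last exact: s2.
  by apply: differentiableZ; exact: s1.
- apply: subclosed_compact (compactU k1 k2) sub.
  exact: closed_closure.
- by apply: subset_trans sub _ => x [/o1|/o2].
Qed.

Lemma H10_linear a (v w : sobolev R d) : H10 Om v -> H10 Om w -> H10 Om (a *: v + w).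
Proof.
move=> /H10P[Lv Lg [phi [t c1 c2]]] /H10P[Lv' Lg' [phi' [t' c1' c2']]].
have L1 : L2 (a *: v + w).1 by apply: L2D => //; exact: L2Z.
have L2' : VL2 (a *: v + w).2.
  apply/(Lp_mx2P mOm) => i; under eq_fun do rewrite !mxE.
  by apply: L2D => //; [apply: L2Z => //|]; exact: L2_coord.
apply/H10P; split => //; exists (fun j x => a * phi j x + phi' j x); split.
- by move=> j; exact: test_fun_linear.
- apply: (L2norm_cvg0_linear (r := a)) c1 c1'.
  + by move=> j; apply: L2B => //; exact: test_fun_L2.
  + by move=> j; apply: L2B => //; exact: test_fun_L2.
  + move=> j x; change (a * phi j x + phi' j x - (a * v.1 x + w.1 x) =
      a * (phi j x - v.1 x) + (phi' j x - w.1 x)); ring.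
- move=> i; apply: (L2norm_cvg0_linear (r := a)) (c2 i) (c2' i).
  + by move=> j; apply: L2B => //; [exact: test_fun_derive_L2|exact: L2_coord].
  + by move=> j; apply: L2B => //; [exact: test_fun_derive_L2|exact: L2_coord].
  + move=> j x; have [s _ _] := t j; have [s' _ _] := t' j.
    have d1 : derivable (phi j) x (delta_mx 0 i) := diff_derivable (s [::] x).
    have d2 : derivable (phi' j) x (delta_mx 0 i) := diff_derivable (s' [::] x).
    rewrite !mxE (_ : (fun x => _ + _) = a \*: phi j + phi' j)//.
    rewrite deriveD ?deriveZ//; last exact: derivableZ.
    rewrite (_ : a *: 'D_(delta_mx 0 i) (phi j) x = a * D i (phi j) x)//; ring.
Qed.

Lemma H10_0 : H10 Om (0 : sobolev R d).
Proof.
have t0 : test_fun Om (fun=> 0).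
  have e0 : [set x : Rd | (0 : R) != 0] = set0.
    by apply/seteqP; split => x //=; rewrite eqxx.
  split; rewrite ?e0 ?closure0//; last exact: compact0.
  move=> s; suff -> : foldr (fun w (h : Rd -> R) => 'D_w h) (fun=> 0) s = (fun=> 0).
    by move=> x; exact: differentiable_cst.
  by elim: s => //= w s ->; apply/funext => x; exact: derive_cst.
have L0 : L2norm Om (fun=> 0) = 0 by rewrite L2norm_ae0//; [exact: L20|exact: ae_inW].
apply/H10P; split; first exact: L20.
  by apply/(Lp_mx2P mOm) => i; under eq_fun do rewrite !mxE; exact: L20.
exists (fun=> (fun=> 0)); split => //.
  rewrite [X in X @ _](_ : _ = (fun=> 0)); first exact: cvg_cst.
  by apply/funext => _; rewrite -[RHS]L0; congr L2norm; apply/funext => x; rewrite /= subr0.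
move=> i; rewrite [X in X @ _](_ : _ = (fun=> 0)); first exact: cvg_cst.
apply/funext => _; rewrite -[RHS]L0; congr L2norm; apply/funext => x.
by rewrite derive_cst mxE subr0.
Qed.

End test_functions.

(** * Solving a linear problem on a space determined by finitely many values *)

Section finite_dimensional_solve.
Context (R : realType) (V : lmodType R) (N : nat).
Variables (U : V -> Prop) (ev : V -> 'rV[R]_N).
Hypothesis U0 : U 0.
Hypothesis U_linear : forall a v w, U v -> U w -> U (a *: v + w).
Hypothesis ev_linear : forall a v w, ev (a *: v + w) = a *: ev v + ev w.

Lemma ev_sum n (c : 'I_n -> R) (e : 'I_n -> V) :
  ev (\sum_i c i *: e i) = \sum_i c i *: ev (e i).
Proof.
have ev0 : ev 0 = 0.
  have := ev_linear (-1) 0 0; rewrite scaleN1r oppr0 addr0 scaleN1r.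
  by rewrite addNr.
elim/big_rec2: _ => // i y x _ <-; exact: ev_linear.
Qed.

Lemma U_sum (I : Type) (s : seq I) (c : I -> R) (e : I -> V) :
  (forall i, U (e i)) -> U (\sum_(i <- s) c i *: e i).
Proof. by move=> Ue; elim/big_rec: _ => // i x _ Ux; exact: U_linear. Qed.

(** A family in U whose values under ev are independent and which is of maximal
    length spans U modulo the kernel of ev. *)
Lemma finite_spanning_family : exists (n : nat) (e : 'I_n -> V),
  (forall i, U (e i)) /\
  forall v, U v -> exists c : 'I_n -> R, ev (v - \sum_i c i *: e i) = 0.
Proof.
pose indep n := exists e : 'I_n -> V,
  (forall i, U (e i)) /\ row_free (\matrix_i ev (e i)).
have ex_indep : exists n, `[< indep n >].
  exists 0; apply/asboolP; exists (fun=> 0).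
  by split=> [[]//|]; rewrite /row_free flatmx0 mxrank0.
have indep_le n : `[< indep n >] -> (n <= N)%N.
  by move=> /asboolP[e [_ /eqP <-]]; exact: rank_leq_col.
have [n /asboolP[e [Ue fe]] nmax] := ex_maxnP ex_indep indep_le.
exists n, e; split => // v Uv.
have [/submxP[c vc]|vM] := boolP (ev v <= \matrix_i ev (e i))%MS.
  exists (c 0); rewrite addrC -scaleN1r ev_linear ev_sum vc mulmx_sum_row.
  by under [in X in _ + X]eq_bigr do rewrite rowK; rewrite scaleN1r addNr.
suff /nmax : `[< indep n.+1 >] by rewrite ltnn.
apply/asboolP; exists (fun i => if unlift ord0 i is Some j then e j else v).
split=> [i|]; first by case: (unlift _ _).
apply: inj_row_free => u; rewrite mulmx_sum_row big_ord_recl rowK unlift_none.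
under eq_bigr do rewrite rowK liftK.
pose u' := \row_j u 0 (lift ord0 j).
have tailE : \sum_(j < n) u 0 (lift ord0 j) *: ev (e j) = u' *m (\matrix_i ev (e i)).
  by rewrite mulmx_sum_row; apply: eq_bigr => j _; rewrite rowK mxE.
rewrite tailE => uM; have u00 : u 0 ord0 = 0.
  apply/eqP; apply: contraNT vM => u00.
  have uE : u 0 ord0 *: ev v = - (u' *m (\matrix_i ev (e i))).
    by apply/eqP; rewrite -addr_eq0 uM.
  have -> : ev v = (- (u 0 ord0)^-1 *: u') *m \matrix_i ev (e i).
    by rewrite -scalemxAl scaleNr -scalerN -uE scalerA mulVf// scale1r.
  exact: submxMl.
have u'0 : u' = 0.
  by apply: (row_free_inj fe); rewrite mul0mx -uM u00 scale0r add0r.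
apply/rowP => i; rewrite mxE; have [j ->|->//] := unliftP ord0 i.
by have /rowP/(_ j) := u'0; rewrite !mxE.
Qed.

Variables (L : V -> V -> R) (r : V -> R).
Hypothesis L_linearl : forall a v v' w, U v -> U v' -> U w ->
  L (a *: v + v') w = a * L v w + L v' w.
Hypothesis L_linearr : forall a v w w', U v -> U w -> U w' ->
  L v (a *: w + w') = a * L v w + L v w'.
Hypothesis r_linear : forall a w w', U w -> U w' -> r (a *: w + w') = a * r w + r w'.
Hypothesis L_ker : forall z w, U z -> U w -> ev z = 0 -> L z w = 0 /\ L w z = 0.
Hypothesis adj_inj : forall z, U z -> (forall w, U w -> L w z = 0) -> r z = 0.

Let L0l w : U w -> L 0 w = 0.
Proof.
by move=> Uw; have := L_linearl (-1) U0 U0 Uw; rewrite scaleN1r oppr0 addr0 mulN1r addNr.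
Qed.

Let L0r v : U v -> L v 0 = 0.
Proof.
by move=> Uv; have := L_linearr (-1) Uv U0 U0; rewrite scaleN1r oppr0 addr0 mulN1r addNr.
Qed.

Let r0 : r 0 = 0.
Proof.
by have := r_linear (-1) U0 U0; rewrite scaleN1r oppr0 addr0 mulN1r addNr.
Qed.

Let L_suml (I : Type) (s : seq I) (c : I -> R) (e : I -> V) w :
  (forall i, U (e i)) -> U w ->
  L (\sum_(i <- s) c i *: e i) w = \sum_(i <- s) c i * L (e i) w.
Proof.
move=> Ue Uw; elim: s => [|i s IH]; first by rewrite !big_nil L0l.
by rewrite !big_cons L_linearl ?IH//; exact: U_sum.
Qed.

Let L_sumr (I : Type) (s : seq I) (c : I -> R) (e : I -> V) v :
  (forall i, U (e i)) -> U v ->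
  L v (\sum_(i <- s) c i *: e i) = \sum_(i <- s) c i * L v (e i).
Proof.
move=> Ue Uv; elim: s => [|i s IH]; first by rewrite !big_nil L0r.
by rewrite !big_cons L_linearr ?IH//; exact: U_sum.
Qed.

Let r_sum (I : Type) (s : seq I) (c : I -> R) (e : I -> V) :
  (forall i, U (e i)) ->
  r (\sum_(i <- s) c i *: e i) = \sum_(i <- s) c i * r (e i).
Proof.
move=> Ue; elim: s => [|i s IH]; first by rewrite !big_nil r0.
by rewrite !big_cons r_linear ?IH//; exact: U_sum.
Qed.

(** The Fredholm alternative for the matrix M of L on the spanning family e: the
    row of right-hand sides is in the row space of M as soon as it annihilates
    the kernel of M, and a vector y of the kernel is a combination z of the e_i
    with L w z = 0 for every w, for which r z = 0. Elements of the kernel of ev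
    are invisible to L, so testing against the family is enough. *)
Lemma form_solvable : exists2 v, U v & forall w, U w -> L v w = r w.
Proof.
have [n [e [Ue span]]] := finite_spanning_family.
have decomp v : U v -> exists c : 'I_n -> R, exists z,
    [/\ U z, ev z = 0 & v = \sum_i c i *: e i + z].
  move=> Uv; have [c c0] := span v Uv; exists c, (v - \sum_i c i *: e i).
  split=> //; last by rewrite addrC subrK.
  by rewrite addrC -scaleN1r; apply: U_linear => //; exact: U_sum.
pose M : 'M[R]_n := \matrix_(i, j) L (e i) (e j).
pose rho : 'rV[R]_n := \row_j r (e j).
have Lrho (y : 'cV[R]_n) : M *m y = 0 -> rho *m y = 0.
  move=> My0; pose z := \sum_i y i 0 *: e i.
  have Uz : U z by exact: U_sum.
  have Lez i : L (e i) z = 0.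
    have /matrixP/(_ i 0) := My0; rewrite !mxE => My.
    rewrite L_sumr// -[RHS]My.
    by apply: eq_bigr => j _; rewrite mxE mulrC.
  have rz : r z = 0.
    apply: adj_inj => // w /decomp[c [z' [Uz' ez' ->]]].
    have -> : \sum_i c i *: e i + z' = 1 *: z' + \sum_i c i *: e i.
      by rewrite scale1r addrC.
    rewrite L_linearl//; last exact: U_sum.
    have [-> _] := L_ker Uz' Uz ez'.
    by rewrite mulr0 add0r L_suml// big1// => i _; rewrite Lez mulr0.
  apply/matrixP => i j; rewrite [RHS]mxE !ord1 mxE -[RHS]rz r_sum//.
  by apply: eq_bigr => k _; rewrite mxE mulrC.
have : (rho <= M)%MS.
  rewrite submxE; apply/eqP/matrixP => i j.
  have h : col j (rho *m cokermx M) = 0.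
    by rewrite colE -mulmxA -colE Lrho// colE mulmxA mulmx_coker mul0mx.
  by have /matrixP/(_ i 0) := h; rewrite [X in X = _ -> _]mxE => ->; rewrite !mxE.
move=> /submxP[x rhox]; exists (\sum_i x 0 i *: e i); first exact: U_sum.
move=> w Uw; have [c [z [Uz ez ->]]] := decomp w Uw.
have Uv : U (\sum_i x 0 i *: e i) by exact: U_sum.
have rz : r z = 0 by apply: adj_inj => // w' Uw'; exact: (L_ker Uz Uw' ez).2.
have -> : \sum_i c i *: e i + z = 1 *: z + \sum_i c i *: e i.
  by rewrite scale1r addrC.
have Uce : U (\sum_i c i *: e i) by exact: U_sum.
rewrite L_linearr// r_linear// rz (L_ker Uz Uv ez).2.
congr (_ + _); rewrite L_sumr// r_sum//; apply: eq_bigr => j _; congr (_ * _).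
rewrite L_suml//; have /rowP/(_ j) := rhox; rewrite !mxE => ->.
by apply: eq_bigr => k _; rewrite mxE.
Qed.

End finite_dimensional_solve.

(** * Essentially bounded coefficients *)

Section Linfty.
Context (R : realType) (d : nat) (Om : set 'rV[R]_d).
Local Notation Rd := 'rV[R]_d.
Local Notation mu := (lebesgue_rV R d).

Lemma Lpnorm_pinfty_leP (f : Rd -> R) B : 0 <= B ->
  (Lpnorm Om +oo%E f <= B%:E)%E <-> ae_in Om (fun x => `|f x| <= B).
Proof.
move=> B0; rewrite /Lpnorm unlock; case: ifPn => [mu0|].
  have E x : (abse \o (EFin \o (f \_ Om))) x = `|(f \_ Om) x|%:E by [].
  split=> [/ess_supP|h].
    apply: filterS => x; rewrite E lee_fin patchE => h Ox.
    by move: h; rewrite mem_set.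
  apply/ess_supP; move: h; rewrite /ae_in; apply: filterS => x h; rewrite E lee_fin patchE.
  by case: ifPn => [/set_mem/h//|_]; rewrite (_ : point = 0 :> R)// normr0.
rewrite -leNgt => mu0; split=> [_|_]; last by rewrite lee_fin.
by apply: measure0_ae; apply/eqP; rewrite eq_le mu0 measure_ge0.
Qed.

Lemma Linfty_mx_bounded m n (f : Rd -> 'M[R]_(m, n)) : Lp_mx Om +oo%E f ->
  exists2 B, 0 <= B & ae_in Om (fun x => fnorm (f x) <= B).
Proof.
move=> [_ fy]; have n0 : (0 <= Lpnorm_mx Om +oo%E f)%E by exact: Lnorm_ge0.
have fin : Lpnorm_mx Om +oo%E f \is a fin_num by rewrite ge0_fin_numE.
exists (fine (Lpnorm_mx Om +oo%E f)); first exact: fine_ge0.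
have /Lpnorm_pinfty_leP : (Lpnorm_mx Om +oo%E f <= (fine (Lpnorm_mx Om +oo%E f))%:E)%E.
  by rewrite fineK.
move=> /(_ (fine_ge0 n0)); rewrite /ae_in; apply: filterS => x h Ox.
exact: le_trans (ler_norm _) (h Ox).
Qed.

Lemma Linfty_mx_leP n (c : Rd -> 'rV[R]_n) B : 0 <= B ->
  (Lp_mx Om +oo%E c /\ (Lpnorm_mx Om +oo%E c <= B%:E)%E) <->
  ((forall i, measurable_fun Om (fun x => c x 0 i)) /\
   ae_in Om (fun x => fnorm (c x) <= B)).
Proof.
move=> B0; split=> [[[mc _]]|[mc cB]].
  move=> /(Lpnorm_pinfty_leP _ B0) cB; split => //.
  by apply: ae_inS cB => x _; apply: le_trans; exact: ler_norm.
have cB' : (Lpnorm_mx Om +oo%E c <= B%:E)%E.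
  apply/(Lpnorm_pinfty_leP _ B0); apply: ae_inS cB => x _ h.
  by rewrite ger0_norm ?fnorm_ge0.
split => //; split; first by move=> i j; rewrite (ord1 i).
by apply: le_lt_trans cB' _; rewrite ltry.
Qed.

End Linfty.

(** * The advection-diffusion form *)

Section elliptic_form.
Context (R : realType) (d : nat) (Om : set 'rV[R]_d).
Hypotheses (oOm : open Om) (bOm : bounded_set Om).
Local Notation Rd := 'rV[R]_d.
Local Notation sob := (sobolev R d).
Local Notation mu := (lebesgue_rV R d).
Local Notation L2 f := (Lp Om 2%:E f).
Local Notation VL2 g := (Lp_mx Om 2%:E g).

Let mOm : measurable Om := open_measurable_rV oOm.

Lemma VL2_linear a (g g' : Rd -> Rd) : VL2 g -> VL2 g' ->
  VL2 (fun x => a *: g x + g' x).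
Proof.
move=> /(Lp_mx2P mOm) Lg /(Lp_mx2P mOm) Lg'; apply/(Lp_mx2P mOm) => i.
by under eq_fun do rewrite !mxE; apply: L2D => //; exact: L2Z.
Qed.

Lemma vip_linear a (g g' h : Rd -> Rd) : VL2 g -> VL2 g' -> VL2 h ->
  vip Om (fun x => a *: g x + g' x) h = a * vip Om g h + vip Om g' h.
Proof.
move=> Lg Lg' Lh; rewrite !vipE//; last exact: VL2_linear.
rewrite mulr_sumr -big_split; apply: eq_bigr => i _ /=.
rewrite -ip_linear//; [|exact: L2_coord..].
by congr ip; apply/funext => x; rewrite !mxE.
Qed.

Lemma vip_ae (g h g' h' : Rd -> Rd) : VL2 g -> VL2 h -> VL2 g' -> VL2 h' ->
  ae_in Om (fun x => dot (g x) (h x) = dot (g' x) (h' x)) ->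
  vip Om g h = vip Om g' h'.
Proof.
move=> Lg Lh Lg' Lh' e; congr fine; apply: ae_eq_integral => //.
- by apply/measurable_EFinP; apply: measurable_dot => // i; [have [mg _] := Lg|have [mg _] := Lh]; exact: mg.
- by apply/measurable_EFinP; apply: measurable_dot => // i; [have [mg _] := Lg'|have [mg _] := Lh']; exact: mg.
- by apply: ae_inS e => x Ox /= ->.
Qed.

Context (nu : R) (D : Rd -> 'M[R]_d).
Hypothesis stabD : stabilization Om D.
Local Notation A x := ((nu%:M + D x)^T).

Lemma VL2_diffusion (g : Rd -> Rd) : VL2 g -> VL2 (fun x => g x *m A x).
Proof.
move=> Lg; apply/(Lp_mx2P mOm) => i; under eq_fun do rewrite mxE.
apply: L2_sum => // j; have [B B0 DB] := Linfty_mx_bounded stabD.1.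
under eq_fun do rewrite mulrC.
apply: (@L2_bounded _ _ _ mOm (`|nu| + B)); last exact: L2_coord.
  under eq_fun do rewrite !mxE.
  by apply: measurable_funD => //; exact: stabD.1.1.
apply: ae_inS DB => x _ h; rewrite !mxE (le_trans (ler_normD _ _))// lerD//.
  by case: eqP => _; rewrite ?mulr1n// mulr0n normr0.
exact: le_trans (normr_le_fnorm _ _ _) h.
Qed.

Lemma diffusion_linearl a (u u' v : sob) : VL2 u.2 -> VL2 u'.2 -> VL2 v.2 ->
  diffusion Om nu D (a *: u + u') v = a * diffusion Om nu D u v + diffusion Om nu D u' v.
Proof.
move=> Lu Lu' Lv; rewrite /diffusion -vip_linear//; [|exact: VL2_diffusion..].
by congr vip; apply/funext => x; rewrite scalemxAl -mulmxDl.
Qed.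

Lemma diffusionC (u v : sob) : VL2 u.2 -> VL2 v.2 ->
  diffusion Om nu D u v = diffusion Om nu D v u.
Proof.
move=> Lu Lv; rewrite /diffusion; apply: vip_ae => //; try exact: VL2_diffusion.
apply: ae_inS stabD.2 => x _ [sD _].
have sA : A x = nu%:M + D x by rewrite linearD/= tr_scalar_mx sD.
have dotE (p q : Rd) : dot p q = (p *m q^T) 0 0.
  by rewrite mxE; apply: eq_bigr => i _; rewrite mxE.
rewrite !dotE; have -> : u.2 x *m A x *m (v.2 x)^T = (v.2 x *m A x *m (u.2 x)^T)^T.
  by rewrite !trmx_mul !trmxK sA mulmxA.
by rewrite [LHS]mxE.
Qed.

Lemma diffusion_linearr a (u v v' : sob) : VL2 u.2 -> VL2 v.2 -> VL2 v'.2 ->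
  diffusion Om nu D u (a *: v + v') = a * diffusion Om nu D u v + diffusion Om nu D u v'.
Proof.
move=> Lu Lv Lv'; rewrite diffusionC ?diffusion_linearl//; last exact: VL2_linear.
by rewrite !(diffusionC Lu).
Qed.

Context (B : R) (c : Rd -> Rd).
Hypothesis mc : forall i, measurable_fun Om (fun x => c x 0 i).
Hypothesis cB : ae_in Om (fun x => fnorm (c x) <= B).

Definition advection_diffusion (w v : sob) : R :=
  diffusion Om nu D w v + ip Om (fun x => dot (c x) (w.2 x)) v.1.
Local Notation L := advection_diffusion.

Lemma advection_diffusion_linearl a (u u' v : sob) :
  VL2 u.2 -> VL2 u'.2 -> VL2 v.2 -> L2 v.1 ->
  L (a *: u + u') v = a * L u v + L u' v.
Proof.
move=> Lu Lu' Lv Lv1; rewrite /L diffusion_linearl//.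
have -> : (fun x => dot (c x) ((a *: u + u').2 x)) =
    (fun x => a * dot (c x) (u.2 x) + dot (c x) (u'.2 x)).
  by apply/funext => x; rewrite -dotZr -dotDr.
rewrite ip_linear//; [|exact: L2_dot cB _..].
by rewrite mulrDr addrACA.
Qed.

Lemma advection_diffusion_linearr a (u v v' : sob) :
  VL2 u.2 -> VL2 v.2 -> VL2 v'.2 -> L2 v.1 -> L2 v'.1 ->
  L u (a *: v + v') = a * L u v + L u v'.
Proof.
move=> Lu Lv Lv' Lv1 Lv1'; rewrite /L diffusion_linearr//.
rewrite (ipC _ _ (a *: v + v').1) (ipC _ _ v.1) (ipC _ _ v'.1).
rewrite [ip _ (a *: v + v').1 _](@ip_linear _ _ _ mOm a v.1 v'.1)//; last exact: L2_dot cB _.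
by rewrite mulrDr addrACA.
Qed.

Lemma advection_diffusion_ae0 (z w : sob) : VL2 z.2 -> VL2 w.2 -> L2 z.1 -> L2 w.1 ->
  (forall x, Om x -> z.1 x = 0) -> ae_in Om (fun x => z.2 x = 0) ->
  L z w = 0 /\ L w z = 0.
Proof.
move=> Lz Lw Lz1 Lw1 z1 z2.
have VL0 : VL2 (fun=> 0 : Rd).
  by apply/(Lp_mx2P mOm) => i; under eq_fun do rewrite mxE; exact: L20.
have dif0 : diffusion Om nu D w z = 0.
  rewrite /diffusion (@vip_ae _ _ (fun=> 0) (fun=> 0))//.
  - by rewrite /vip; under eq_Rintegral do rewrite dot0r; rewrite Rintegral_cst ?mul0r.
  - exact: VL2_diffusion.
  - by apply: ae_inS z2 => x _ ->; rewrite !dot0r.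
have ip0 h : ip Om (fun=> 0) h = 0.
  by rewrite /ip; under eq_Rintegral do rewrite mul0r; rewrite Rintegral_cst ?mul0r.
have L0 : L2 (fun=> 0) by exact: L20.
split.
  rewrite /L diffusionC// dif0 add0r (@ip_ae _ _ _ mOm _ _ (fun=> 0) w.1)//.
    exact: L2_dot cB _.
  by apply: ae_inS z2 => x _ ->; rewrite dot0r.
rewrite /L dif0 add0r (@ip_ae _ _ _ mOm _ _ (fun=> 0) (fun=> 0))//.
  exact: L2_dot cB _.
by apply: ae_inW => x Ox; rewrite z1// mulr0 mul0r.
Qed.

(** The discrete Kolmogorov-Fokker-Planck operator is the adjoint of the
    linearized Hamilton-Jacobi-Bellman operator. *)
Lemma adjoint_advection_diffusionE (m w : sob) : VL2 m.2 -> VL2 w.2 ->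
  L w m = diffusion Om nu D m w + vip Om (fun x => m.1 x *: c x) w.2.
Proof.
move=> Lm Lw; rewrite /L diffusionC//; congr (_ + _).
by apply: eq_Rintegral => x _; rewrite dotZl mulrC.
Qed.

End elliptic_form.

(** * Sign and size of discrete densities by duality *)

Section discrete_duality.
Context (R : realType) (d : nat) (Om : set 'rV[R]_d).
Hypotheses (oOm : open Om) (bOm : bounded_set Om).
Local Notation Rd := 'rV[R]_d.
Local Notation sob := (sobolev R d).
Local Notation mu := (lebesgue_rV R d).
Local Notation L2 f := (Lp Om 2%:E f).
Local Notation VL2 g := (Lp_mx Om 2%:E g).

Let mOm : measurable Om := open_measurable_rV oOm.

Lemma H10_L2 (v : sob) : H10 Om v -> L2 v.1.
Proof. by case. Qed.

Lemma H10_VL2 (v : sob) : H10 Om v -> VL2 v.2.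
Proof. by case. Qed.

Lemma H1norm_ge0 (v : sob) : 0 <= H1norm Om v.
Proof. exact: sqrtr_ge0. Qed.

Lemma L2norm_le_H1norm (v : sob) : L2norm Om v.1 <= H1norm Om v.
Proof.
rewrite -[leLHS]ger0_norm ?L2norm_ge0// -sqrtr_sqr ler_sqrt ?lerDl ?sqr_ge0//.
by rewrite addr_ge0 ?sqr_ge0.
Qed.

Lemma L2norm_grad_le_H1norm (v : sob) : L2norm_mx Om v.2 <= H1norm Om v.
Proof.
rewrite -[leLHS]ger0_norm ?L2norm_ge0// -sqrtr_sqr ler_sqrt ?lerDr ?sqr_ge0//.
by rewrite addr_ge0 ?sqr_ge0.
Qed.

Lemma L2norm_mxZ a (g : Rd -> Rd) : VL2 g ->
  L2norm_mx Om (fun x => a *: g x) = `|a| * L2norm_mx Om g.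
Proof.
move=> Lg; have Ln := L2_fnorm Lg; rewrite !L2norm_mxE.
have -> : (fun x => fnorm (a *: g x)) = (fun x => `|a| * fnorm (g x)).
  by apply/funext => x; rewrite fnormZ.
by rewrite L2normZ// normr_id.
Qed.

(** Both sides scale, so v can be divided by its H^1 norm, after which its
    gradient has norm at most 1. *)
Lemma Hm1_ratio_le (G : sob -> R) (N : R) (v : sob) :
  Hm1 Om G -> Hm1norm Om G = N%:E -> H10 Om v -> G v / H1norm Om v <= N.
Proof.
move=> [Glin _] GN Hv.
have G0 : G 0 = 0.
  have h0 := H10_0 oOm bOm.
  by have := Glin (-1) _ _ h0 h0; rewrite scaleN1r oppr0 addr0 mulN1r addNr.
have GZ a w : H10 Om w -> G (a *: w) = a * G w.
  by move=> Hw; rewrite -[a *: w]addr0 Glin// ?G0 ?addr0//; exact: H10_0.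
have ub w : H10 Om w -> L2norm_mx Om w.2 <= 1 -> G w <= N.
  by move=> Hw w1; rewrite -lee_fin -GN; apply: ereal_sup_ubound; exists w.
have [h0|h0] := eqVneq (H1norm Om v) 0.
  rewrite h0 invr0 mulr0 -G0; apply: ub; first exact: H10_0.
  have -> : (0 : sob).2 = (fun x => 0 *: (0 : sob).2 x).
    by apply/funext => x; rewrite scale0r.
  by rewrite L2norm_mxZ ?normr0 ?mul0r//; exact: (H10_VL2 (H10_0 oOm bOm)).
have hp : 0 < H1norm Om v by rewrite lt_neqAle eq_sym h0 H1norm_ge0.
rewrite mulrC -GZ//; apply: ub.
  by rewrite -[_ *: v]addr0; apply: H10_linear => //; exact: H10_0.
rewrite [L2norm_mx _ _](@L2norm_mxZ (H1norm Om v)^-1 v.2); last exact: H10_VL2.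
by rewrite gtr0_norm ?invr_gt0// mulrC ler_pdivrMr// mul1r L2norm_grad_le_H1norm.
Qed.

Context (T : seq {ffun 'I_d.+1 -> Rd}).
Hypothesis meshT : mesh Om T.
Local Notation V := (Vh Om T).

Lemma Vh_linear a (v w : sob) : V v -> V w -> V (a *: v + w).
Proof.
move=> [Hv Av] [Hw Aw]; split; first exact: H10_linear.
move=> K KT; have [p [b pb]] := Av K KT; have [q [c qc]] := Aw K KT.
exists (a *: p + q), (a * b + c) => x Kx.
rewrite [LHS](_ : _ = a * v.1 x + w.1 x)// (pb x Kx) (qc x Kx).
by rewrite dotDl dotZl; ring.
Qed.

Lemma Vh_0 : V 0.
Proof.
split; first exact: H10_0.
by move=> K KT; exists 0, 0 => x _; rewrite dotC dot0r addr0.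
Qed.

(** A function which is affine on each simplex is recovered from its values at
    the vertices by convex combinations. *)
Lemma Vh_vertex_combination (v : sob) x : V v -> Om x ->
  exists n (t : 'I_n -> R) (p : 'I_n -> Rd), [/\ forall i, 0 <= t i,
    forall i, vertex T (p i) & v.1 x = \sum_i t i * v.1 (p i)].
Proof.
move=> [_ Av] Ox; have [_ cov _] := meshT.
have : closure Om x by exact: subset_closure.
rewrite -cov => -[K /= KT Kx]; have [n [t [p [t0 t1 pK xE]]]] := Kx.
exists n, t, p; split => //; first by move=> i; exists K.
have [q [c qc]] := Av K KT.
have Kp i : simplex K (p i).
  exists 1, (fun=> 1), (fun=> p i); split => //; first by rewrite big_ord1.
  by rewrite big_ord1 scale1r.
rewrite (qc x Kx) (eq_bigr (fun i => t i * dot q (p i) + t i * c)); last first.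
  by move=> i _; rewrite (qc _ (Kp i)) mulrDr.
rewrite big_split/= -mulr_suml t1 mul1r xE; congr (_ + _).
elim/big_rec2: _ => [|i y z _ <-]; first by rewrite dot0r.
by rewrite dotDr dotZr.
Qed.

Lemma Vh_ge0 (v : sob) : V v -> (forall y, vertex T y -> 0 <= v.1 y) ->
  forall x, Om x -> 0 <= v.1 x.
Proof.
move=> Vv v0 x Ox; have [n [t [p [t0 pT ->]]]] := Vh_vertex_combination Vv Ox.
by apply: sumr_ge0 => i _; rewrite mulr_ge0// v0.
Qed.

Lemma Vh_eq0 (v : sob) : V v -> (forall y, vertex T y -> v.1 y = 0) ->
  forall x, Om x -> v.1 x = 0.
Proof.
move=> Vv v0 x Ox; have [n [t [p [t0 pT ->]]]] := Vh_vertex_combination Vv Ox.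
by apply: big1 => i _; rewrite v0 ?mulr0.
Qed.

Lemma nodal_ge0 a (xi : sob) x : nodal Om T a xi -> Om x -> 0 <= xi.1 x.
Proof.
move=> [Vxi xia xi0]; apply: Vh_ge0 => // y yT.
have [->|ya] := eqVneq y a; first by rewrite xia.
by rewrite xi0//; exact/eqP.
Qed.

Lemma stable_H1norm_le Cstab L w B : 0 < Cstab -> stable Om T Cstab L -> V w ->
  (forall v, V v -> L w v / H1norm Om v <= B) -> H1norm Om w <= Cstab * B.
Proof.
move=> C0 sL Vw LB; rewrite -lee_fin EFinM; apply: le_trans (sL w Vw) _.
apply: lee_wpmul2l; first by rewrite lee_fin ltW.
by apply: ge_ereal_sup => _ [v Vv <-]; rewrite lee_fin LB.
Qed.

Context (nu Cstab B : R) (D : Rd -> 'M[R]_d) (c : Rd -> Rd).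
Hypothesis stabD : stabilization Om D.
Hypothesis mc : forall i, measurable_fun Om (fun x => c x 0 i).
Hypothesis cB : ae_in Om (fun x => fnorm (c x) <= B).
Hypothesis Cstab0 : 0 < Cstab.
Local Notation L := (advection_diffusion Om nu D c).
Hypothesis stabL : stable Om T Cstab (adjoint L).

Let nodes : seq Rd := [seq (K : {ffun _ -> _}) i | K <- T, i <- enum 'I_d.+1].

(** V_h is finite-dimensional as far as the form can see: an element vanishing at
    the vertices vanishes on Om, so its weak gradient is zero almost everywhere
    and the form ignores it. Injectivity of the adjoint is its stability. *)
Lemma discrete_problem_solvable (phi : Rd -> R) : L2 phi ->
  exists2 v, V v & forall w, V w -> L v w = ip Om phi w.1.
Proof.
move=> Lphi.
pose ev (v : sob) : 'rV[R]_(size nodes) := \row_j v.1 (tnth (in_tuple nodes) j).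
apply: (@form_solvable _ _ _ V ev) => //.
- exact: Vh_0.
- by move=> a v w; exact: Vh_linear.
- by move=> a v w; apply/rowP => j; rewrite !mxE.
- move=> a v v' w [Hv _] [Hv' _] [Hw _].
  by apply: (advection_diffusion_linearl oOm nu stabD mc cB) => //; first [exact: H10_VL2|exact: H10_L2].
- move=> a v w w' [Hv _] [Hw _] [Hw' _].
  by apply: (advection_diffusion_linearr oOm nu stabD mc cB) => //; first [exact: H10_VL2|exact: H10_L2].
- move=> a w w' [Hw _] [Hw' _]; rewrite ipC (ipC _ _ w.1) (ipC _ _ w'.1).
  by apply: ip_linear => //; exact: H10_L2.
- move=> z w Vz Vw ez.
  have z1 : forall x, Om x -> z.1 x = 0.
    apply: Vh_eq0 => // y [K KT [i _ <-]].
    have : K i \in in_tuple nodes by apply/allpairsP; exists (K, i); rewrite mem_enum.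
    move=> /tnthP[j ->]; by have /rowP/(_ j) := ez; rewrite !mxE.
  have [Hz _] := Vz; have [Hw _] := Vw.
  apply: (advection_diffusion_ae0 oOm nu stabD mc cB) => //.
  + exact: H10_VL2.
  + exact: H10_VL2.
  + exact: H10_L2.
  + exact: H10_L2.
  + exact: H10_grad_eq0 Hz z1.
- move=> z Vz Lz; have [Hz _] := Vz; have Lz1 := H10_L2 Hz.
  have z0 : L2norm Om z.1 = 0.
    apply/eqP; rewrite eq_le L2norm_ge0 andbT.
    apply: le_trans (L2norm_le_H1norm z) _; rewrite -(mulr0 Cstab).
    apply: stable_H1norm_le stabL Vz _ => // v Vv.
    by rewrite /adjoint Lz// mul0r.
  apply/eqP; rewrite -normr_le0; apply: le_trans (CauchySchwarz_ip mOm Lphi Lz1) _.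
  by rewrite z0 mulr0.
Qed.

Variables (G : sob -> R) (m : sob).
Hypothesis Gm : Hm1_ge0 Om G.
Hypothesis Vm : V m.
Hypothesis Lm : forall w, V w -> L w m = G w.
Hypothesis dmpL : dmp Om T L.

(** Let v solve the problem for L with right-hand side phi >= 0. Nodal functions
    are nonnegative, so the discrete maximum principle applies to v and gives
    v >= 0; then ip phi m = L v m = G v >= 0. This is the nonnegativity of the
    density m tested against phi. *)
Lemma discrete_density_ge0 (phi : Rd -> R) : L2 phi ->
  ae_in Om (fun x => 0 <= phi x) -> 0 <= ip Om phi m.1.
Proof.
move=> Lphi phi0; have [v Vv Lv] := discrete_problem_solvable Lphi.
rewrite -Lv// Lm//; apply: Gm; first exact: Vv.1.
apply: ae_inW; apply: dmpL => // a xi aT Oa nxi; have [Vxi _ _] := nxi.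
rewrite Lv//; have Lxi := H10_L2 Vxi.1; have L0 := L20 mOm.
have <- : ip Om (fun=> 0) xi.1 = 0.
  by rewrite /ip; under eq_Rintegral do rewrite mul0r; rewrite Rintegral_cst ?mul0r.
apply: ip_ae_le => //; apply: ae_inS phi0 => x Ox p0.
by rewrite mul0r mulr_ge0// (nodal_ge0 nxi).
Qed.

Lemma discrete_density_bound (N : R) : Hm1 Om G -> Hm1norm Om G = N%:E ->
  L2norm Om m.1 <= Cstab * N.
Proof.
move=> HG GN; apply: le_trans (L2norm_le_H1norm m) _.
apply: stable_H1norm_le stabL Vm _ => // v Vv.
by rewrite /adjoint Lm//; apply: Hm1_ratio_le HG GN _; exact: Vv.1.
Qed.

End discrete_duality.

(** * The Moreau-Yosida envelope of a Lipschitz convex function *)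

Section moreau_envelope.
Context (R : realType) (n : nat).
Local Notation Rn := 'rV[R]_n.
Implicit Types p q r v : Rn.

Lemma fnorm_lipschitz_continuous (h : Rn -> R) (L : R) :
  (forall p q, h p <= h q + L * fnorm (p - q)) -> continuous h.
Proof.
move=> hL p; have ? := nbhs_filter p; apply/cvgrPdist_lt => e e0.
pose M := `|L| * n%:R + 1; have M0 : 0 < M by rewrite ltr_wpDl// mulr_ge0.
have eM : 0 < e / M by rewrite divr_gt0.
apply: (@filterS _ (nbhs p) (nbhs_filter p) _ _ _ (nbhsx_ballx p _ eM)) => q.
move=> /ball_rVP[_ pq].
have fpq : fnorm (p - q) <= n%:R * (e / M).
  apply: le_trans (fnorm_le_sum _) _.
  have -> : n%:R * (e / M) = \sum_(i < n) (e / M).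
    by rewrite sumr_const card_ord mulr_natl.
  by apply: ler_sum => i _; rewrite !mxE ltW.
have Le : `|L| * fnorm (p - q) < e.
  apply: (@le_lt_trans _ _ (`|L| * (n%:R * (e / M)))); first by rewrite ler_wpM2l.
  have -> : `|L| * (n%:R * (e / M)) = e * (`|L| * n%:R / M) by ring.
  by rewrite gtr_pMr// ltr_pdivrMr// mul1r /M ltrDl.
have LL : L * fnorm (p - q) <= `|L| * fnorm (p - q).
  by rewrite ler_wpM2r ?fnorm_ge0 ?ler_norm.
have := hL p q; have := hL q p; rewrite (fnormB q p) => h1 h2.
by rewrite ltr_norml; apply/andP; split; lra.
Qed.

Context (H : Rn -> Rn -> R) (x : Rn) (L lam : R).
Hypothesis lam0 : 0 < lam.
Hypothesis H_lip : forall p q, H x p <= H x q + L * fnorm (p - q).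
Hypothesis H_convex : forall p q s, 0 <= s <= 1 ->
  H x (s *: p + (1 - s) *: q) <= s * H x p + (1 - s) * H x q.
Local Notation M := (moreau_yosida H lam x).
Local Notation k := ((2 * lam)^-1).

Let k0 : 0 < k. Proof. by rewrite invr_gt0 mulr_gt0. Qed.

(** With t = |q - p|, the right-hand side is at least H p - L t + t^2 / (2 lam),
    and completing the square bounds this below. *)
Lemma moreau_objective_ge p q :
  H x p - lam * L ^+ 2 / 2 <= H x q + k * fnorm (q - p) ^+ 2.
Proof.
have := H_lip p q; rewrite fnormB; set t := fnorm (q - p) => h.
suff : L * t <= k * t ^+ 2 + lam * L ^+ 2 / 2 by lra.
rewrite -subr_ge0 (_ : _ - _ = k * (t - lam * L) ^+ 2).
  by rewrite mulr_ge0 ?sqr_ge0// ltW.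
by field; rewrite gt_eqF.
Qed.

Lemma moreau_le p q : M p <= H x q + k * fnorm (q - p) ^+ 2.
Proof.
apply: ge_inf; last by exists q.
by exists (H x p - lam * L ^+ 2 / 2) => _ [r _ <-]; exact: moreau_objective_ge.
Qed.

Lemma moreau_ge p c : (forall q, c <= H x q + k * fnorm (q - p) ^+ 2) -> c <= M p.
Proof.
move=> h; apply: lb_le_inf; first by exists (H x p + k * fnorm (p - p) ^+ 2), p.
by move=> _ [q _ <-].
Qed.

Lemma moreau_le_self p : M p <= H x p.
Proof. by have := moreau_le p p; rewrite subrr fnorm0 expr0n mulr0 addr0. Qed.

Lemma moreau_ge_self p : H x p - lam * L ^+ 2 / 2 <= M p.
Proof. by apply: moreau_ge => q; exact: moreau_objective_ge. Qed.

(** Translating the competitor for q by p - q gives a competitor for p. *)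
Lemma moreau_lip p q : M p <= M q + L * fnorm (p - q).
Proof.
rewrite -lerBlDr; apply: moreau_ge => r.
have := moreau_le p (r + (p - q)); have := H_lip (r + (p - q)) r.
by rewrite addrAC subrr add0r addrA addrAC addrK; lra.
Qed.

Lemma moreau_convex p q s : 0 <= s <= 1 ->
  M (s *: p + (1 - s) *: q) <= s * M p + (1 - s) * M q.
Proof.
move=> s01; have /andP[s0 s1] := s01; have s1' : 0 <= 1 - s by rewrite subr_ge0.
have obj r r' : M (s *: p + (1 - s) *: q) <=
    s * (H x r + k * fnorm (r - p) ^+ 2) + (1 - s) * (H x r' + k * fnorm (r' - q) ^+ 2).
  apply: le_trans (moreau_le _ (s *: r + (1 - s) *: r')) _.
  have := H_convex r r' s01.
  have -> : s *: r + (1 - s) *: r' - (s *: p + (1 - s) *: q) =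
      s *: (r - p) + (1 - s) *: (r' - q).
    by apply/rowP => i; rewrite !mxE; ring.
  have : fnorm (s *: (r - p) + (1 - s) *: (r' - q)) ^+ 2 <=
      s * fnorm (r - p) ^+ 2 + (1 - s) * fnorm (r' - q) ^+ 2.
    rewrite !sqr_fnorm; move: (r - p) (r' - q) => a b.
    have := dot_self_ge0 (a - b).
    rewrite !(dotDl, dotDr, dotNl, dotNr, dotZl, dotZr) (dotC b a) => h.
    have := mulr_ge0 (mulr_ge0 s0 s1') h; lra.
  move=> /(ler_wpM2l (ltW k0)); lra.
have [->|sn0] := eqVneq s 0.
  by rewrite scale0r add0r mul0r add0r subr0 scale1r mul1r.
have [->|sn1] := eqVneq s 1.
  by rewrite subrr scale0r addr0 mul0r addr0 scale1r mul1r.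
have sp : 0 < s by rewrite lt_neqAle eq_sym sn0.
have sp' : 0 < 1 - s by rewrite subr_gt0 lt_neqAle sn1.
set m := M _ in obj *.
suff : (m - (1 - s) * M q) / s <= M p by rewrite ler_pdivrMr//; lra.
apply: moreau_ge => r.
suff : (m - s * (H x r + k * fnorm (r - p) ^+ 2)) / (1 - s) <= M q.
  by rewrite !ler_pdivrMr//; lra.
by apply: moreau_ge => r'; rewrite ler_pdivrMr//; have := obj r r'; lra.
Qed.

(** Outside the cube of half-width 2 lam |L| about p the quadratic term beats the
    Lipschitz bound, so the infimum is that over a compact set. *)
Lemma moreau_argmin p : exists q,
  (forall i, `|q 0 i - p 0 i| <= 2 * lam * `|L|) /\
  M p = H x q + k * fnorm (q - p) ^+ 2.
Proof.
pose rho := 2 * lam * `|L|; have rho0 : 0 <= rho by rewrite !mulr_ge0// ltW.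
pose K : set Rn := [set q | forall i, `[p 0 i - rho, p 0 i + rho]%classic (q 0 i)].
have KE q : K q <-> forall i, `|q 0 i - p 0 i| <= rho.
  by split=> h i; have := h i; rewrite /= in_itv/= ler_distl.
have cK : compact K.
  exact: (@rV_compact R n (fun i => `[p 0 i - rho, p 0 i + rho]%classic)
    (fun=> @segment_compact R _ _)).
have Kp : K p by apply/KE => i; rewrite subrr normr0.
pose g q := H x q + k * fnorm (q - p) ^+ 2.
have cg : continuous g.
  have c1 : continuous (H x) := fnorm_lipschitz_continuous H_lip.
  have c2 : continuous (fun q => fnorm (q - p)).
    apply: (@fnorm_lipschitz_continuous _ 1) => q r.
    by rewrite mul1r -[q - p](subrKA r) addrC fnormD.
  rewrite -[X in continuous X]/(H x + cst k * ((fun q => fnorm (q - p)) *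
    (fun q => fnorm (q - p)))).
  move=> q; apply: continuousD; first exact: c1.
  apply: continuousM; first exact: cst_continuous.
  by apply: continuousM; exact: c2.
have [q qK qmin] := EVT_min_rV (ex_intro _ p Kp) cK (continuous_subspaceT cg).
exists q; split; first exact/KE/set_mem.
apply/eqP; rewrite eq_le moreau_le; apply: moreau_ge => r.
have [rK|rK] := pselect (K r); first by apply: qmin; exact/mem_set.
have gp : g q <= H x p.
  by have := qmin p (mem_set Kp); rewrite /g subrr fnorm0 expr0n mulr0 addr0.
apply: le_trans gp _.
have rp : rho < fnorm (r - p).
  rewrite ltNge; apply/negP => h; apply: rK; apply/KE => i.
  by apply: le_trans h; have := normr_le_fnorm (r - p) 0 i; rewrite !mxE.
have := H_lip p r; rewrite fnormB; move: rp; set t := fnorm (r - p) => rt h.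
have t0 : 0 <= t by exact: fnorm_ge0.
suff : L * t <= k * t ^+ 2 by lra.
apply: (@le_trans _ _ (`|L| * t)); first by rewrite ler_wpM2r ?ler_norm.
rewrite expr2 mulrA ler_wpM2r// mulrC ler_pdivlMr ?mulr_gt0//.
by rewrite mulrC ltW.
Qed.

(** Let q minimize for p, and s = (p - q) / lam. Using q as a competitor for p'
    gives the upper bound; the lower bound at p' follows from the upper bound at
    the reflected point 2 p - p' by midpoint convexity. *)
Lemma moreau_quadratic p : exists s, forall p',
  `|M p' - M p - dot s (p' - p)| <= k * fnorm (p' - p) ^+ 2.
Proof.
have [q [_ Mq]] := moreau_argmin p; exists (lam^-1 *: (p - q)).
have up p' : M p' <= M p + dot (lam^-1 *: (p - q)) (p' - p) + k * fnorm (p' - p) ^+ 2.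
  apply: le_trans (moreau_le p' q) _; rewrite Mq -!addrA lerD2l !sqr_fnorm.
  have -> : q - p' = (q - p) - (p' - p) by rewrite opprB addrA subrK.
  have -> : p - q = - (q - p) by rewrite opprB.
  move: (q - p) (p' - p) => a b.
  rewrite dotBl !dotBr (dotC b a) scalerN -scaleNr dotZl.
  rewrite le_eqVlt; apply/orP; left; apply/eqP.
  by field; rewrite gt_eqF.
move=> p'; rewrite ler_norml; apply/andP; split; last by have := up p'; lra.
have := up (p + (p - p')).
have -> : p + (p - p') - p = - (p' - p) by rewrite addrAC subrr add0r opprB.
rewrite fnormN dotNr.
have half : 0 <= (2^-1 : R) <= 1 by apply/andP; split; lra.
have := moreau_convex p' (p + (p - p')) half.
have -> : 2^-1 *: p' + (1 - 2^-1) *: (p + (p - p')) = p.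
  by apply/rowP => i; rewrite !mxE; field.
lra.
Qed.

Lemma moreau_grad p :
  (forall i, derivable M p (delta_mx 0 i)) /\
  (forall p', `|M p' - M p - dot (grad M p) (p' - p)| <= k * fnorm (p' - p) ^+ 2).
Proof.
have [s hs] := moreau_quadratic p.
have cv i : (fun t : R => t^-1 *: ((M \o shift p) (t *: delta_mx 0 i) - M p)) @ 0^'
    --> s 0 i.
  apply/cvgrPdist_lt => e e0; near=> t.
  have tn0 : t != 0 by near: t; exact: nbhs_dnbhs_neq.
  have := hs (t *: delta_mx 0 i + p); rewrite addrK dotZr fnormZ fnorm_delta mulr1.
  rewrite dot_delta.
  move=> h; rewrite distrC.
  have -> : t^-1 *: ((M \o shift p) (t *: delta_mx 0 i) - M p) - s 0 i =
      t^-1 * (M (t *: delta_mx 0 i + p) - M p - t * s 0 i).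
    by rewrite mulrBr mulKf.
  rewrite normrM normfV; apply: (@le_lt_trans _ _ (k * `|t|)).
    by rewrite ler_pdivrMl ?normr_gt0// mulrCA -expr2.
  rewrite mulrC -ltr_pdivlMr//.
  near: t; apply: dnbhs0_lt; by rewrite divr_gt0.
have gs : grad M p = s.
  by apply/rowP => i; rewrite mxE /derive; apply/cvg_lim => //; exact: cv.
split; last by rewrite gs.
by move=> i; apply/cvg_ex; exists (s 0 i); exact: cv.
Unshelve. all: by end_near. Qed.

(** Convexity on the segment from p to p' and the lower quadratic bound, divided
    by the length t of a step from p, with t tending to 0. *)
Lemma moreau_subgradient p p' : M p + dot (grad M p) (p' - p) <= M p'.
Proof.
have [_ hs] := moreau_grad p; set s := grad M p in hs *.
have small t : 0 < t -> t <= 1 ->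
    dot s (p' - p) - (k * fnorm (p' - p) ^+ 2) * t <= M p' - M p.
  move=> t0 t1; have t01 : 0 <= t <= 1 by rewrite ltW.
  have := moreau_convex p' p t01; have := hs (t *: p' + (1 - t) *: p).
  have -> : t *: p' + (1 - t) *: p - p = t *: (p' - p).
    by apply/rowP => i; rewrite !mxE; ring.
  rewrite dotZr fnormZ (ger0_norm (ltW t0)) ler_norml => /andP[h1 _] h2.
  rewrite -(ler_pM2l t0) !mulrBr; move: h1; rewrite exprMn; lra.
rewrite addrC -lerBrDr; apply/ler_addgt0Pr => e e0.
pose c := k * fnorm (p' - p) ^+ 2 + 1.
have c0 : 0 < c by rewrite ltr_wpDl// mulr_ge0 ?sqr_ge0// ltW.
pose t := Num.min 1 (e / c).
have t0 : 0 < t by rewrite lt_min ltr01 divr_gt0.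
have t1 : t <= 1 by rewrite ge_min lexx.
have te : t <= e / c by rewrite ge_min lexx orbT.
have := small t t0 t1; move: te; rewrite ler_pdivlMr// /c; lra.
Qed.

Lemma moreau_grad_le p : 0 <= L -> fnorm (grad M p) <= L.
Proof.
move=> L0; set s := grad M p.
have := moreau_subgradient p (s + p); rewrite addrK -sqr_fnorm -/s.
have := moreau_lip (s + p) p; rewrite addrK => h1 h2.
have : fnorm s ^+ 2 <= L * fnorm s by lra.
have [->//|s0] := eqVneq (fnorm s) 0.
by rewrite expr2 ler_pM2r// lt_neqAle eq_sym s0 fnorm_ge0.
Qed.

End moreau_envelope.

(** * Hamiltonians composed with gradients *)

Section hamiltonian_functions.
Context (R : realType) (d : nat) (Om : set 'rV[R]_d).
Hypotheses (oOm : open Om) (bOm : bounded_set Om).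
Local Notation Rd := 'rV[R]_d.
Local Notation mu := (lebesgue_rV R d).
Local Notation L2 f := (Lp Om 2%:E f).
Local Notation VL2 g := (Lp_mx Om 2%:E g).

Let mOm : measurable Om := open_measurable_rV oOm.

(** The modulus of continuity in x may deteriorate as p grows, as it does for
    b(x, a) . p - f(x, a). *)
Definition equicontinuous_in_space (S : set Rd) (H : Rd -> Rd -> R) :=
  forall P e : R, 0 < e -> exists2 r : R, 0 < r &
    forall x y, S x -> S y -> ball x r y ->
    forall p : Rd, \sum_i `|p 0 i| <= P -> `|H x p - H y p| <= e.

Definition lipschitz_in_gradient (L : R) (H : Rd -> Rd -> R) :=
  forall x p q, Om x -> H x p <= H x q + L * fnorm (p - q).

Lemma L2_cst r : L2 (fun=> r).
Proof.
have [M OM] := bounded_set_box bOm.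
apply/(Lp2P mOm); split; first exact: measurable_cst.
apply: (@integrableS _ _ _ _ (box M)) => //; first exact: measurable_box.
apply: measurable_bounded_integrable => //.
- exact: measurable_box.
- exact: box_finite.
- by exists `|r ^+ 2|; split; [exact: num_real|move=> B rB x _; exact: ltW].
Qed.

Lemma equicontinuous_continuous S H p x : Om `<=` S -> Om x ->
  equicontinuous_in_space S H -> {for x, continuous (H^~ p)}.
Proof.
move=> OS Ox eH; have ? := nbhs_filter x; apply/cvgrPdist_le => e e0.
have [r r0 hr] := eH (\sum_i `|p 0 i|) e e0.
have nO : nbhs x Om by exact: open_nbhs_nbhs.
apply: (@filterS2 _ (nbhs x) (nbhs_filter x) _ _ _ _ nO (nbhsx_ballx x _ r0)) => y Oy xy.
exact: hr (OS _ Ox) (OS _ Oy) xy p (lexx _).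
Qed.

Lemma measurable_hamiltonian_gradient H L (w : Rd -> Rd) :
  equicontinuous_in_space Om H -> lipschitz_in_gradient L H ->
  (forall i, measurable_fun Om (fun x => w x 0 i)) ->
  measurable_fun Om (fun x => H x (w x)).
Proof.
move=> eH lH mw; apply: measurable_caratheodory => //.
  move=> p; apply: continuous_measurable_rV => // x Ox.
  exact: equicontinuous_continuous eH.
move=> x Ox; have : continuous (H x).
  by apply: (@fnorm_lipschitz_continuous _ _ _ L) => p q; exact: lH.
exact.
Qed.

Lemma L2_hamiltonian_gradient H L C0 (w : Rd -> Rd) :
  equicontinuous_in_space Om H -> lipschitz_in_gradient L H ->
  (forall x, Om x -> `|H x 0| <= C0) -> VL2 w -> L2 (fun x => H x (w x)).
Proof.
move=> eH lH H0 Lw.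
have Lb : L2 (fun x => `|L| * fnorm (w x) + C0).
  by apply: L2D => //; [apply: L2Z => //; exact: L2_fnorm|exact: L2_cst].
apply: (L2_le mOm _ Lb).
  by apply: measurable_hamiltonian_gradient eH lH _ => i; exact: Lw.1.
apply: ae_inW => x Ox.
have h1 := lH x (w x) 0 Ox; have h2 := lH x 0 (w x) Ox.
rewrite fnormB subr0 in h2; rewrite subr0 in h1.
have := H0 x Ox; rewrite ler_norml => /andP[a1 a2].
have LL : L * fnorm (w x) <= `|L| * fnorm (w x).
  by rewrite ler_wpM2r ?fnorm_ge0 ?ler_norm.
apply: le_trans (ler_norm _).
by rewrite ler_norml; apply/andP; split; lra.
Qed.

Lemma bounded_hamiltonian0 H : equicontinuous_in_space (closure Om) H ->
  exists C0, forall x, Om x -> `|H x 0| <= C0.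
Proof.
move=> eH.
have cK : compact (closure Om).
  have [M OM] := bounded_set_box bOm.
  apply: subclosed_compact (@compact_box R d M) _; first exact: closed_closure.
  have cb : closed (@box R d M).
    exact: compact_closed (@norm_hausdorff _ _) (@compact_box R d M).
  by rewrite ((closure_id _).1 cb); exact: closure_subset.
have cH : {within closure Om, continuous (H^~ 0)}.
  apply/subspace_continuousP => x Kx; have ? := nbhs_filter x.
  apply/cvgrPdist_le => e e0.
  have [r r0 hr] := eH (\sum_(i < d) `|(0 : Rd) 0 i|) e e0.
  apply: (@filterS _ (nbhs x) (nbhs_filter x) _ _ _ (nbhsx_ballx x _ r0)) => y xy Ky.
  exact: hr Kx Ky xy 0 (lexx _).
have /compact_bounded[B [Br hB]] := continuous_compact cH cK.
exists (B + 1) => x Ox; apply: (hB (B + 1)); first by rewrite ltrDl.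
by exists x => //; exact: subset_closure.
Qed.

Section moreau.
Context (H : Rd -> Rd -> R) (L lam : R).
Hypothesis lam0 : 0 < lam.
Hypothesis H_equi : equicontinuous_in_space Om H.
Hypothesis H_lip : lipschitz_in_gradient L H.
Hypothesis H_convex : forall x p q s, Om x -> 0 <= s <= 1 ->
  H x (s *: p + (1 - s) *: q) <= s * H x p + (1 - s) * H x q.
Local Notation M := (moreau_yosida H lam).

Let lipx x : Om x -> forall p q, H x p <= H x q + L * fnorm (p - q).
Proof. by move=> Ox p q; exact: H_lip. Qed.

Lemma moreau_lipschitz_in_gradient : lipschitz_in_gradient L M.
Proof. by move=> x p q Ox; exact: moreau_lip lam0 (lipx Ox) _ _. Qed.

(** A minimizer of the envelope at p is at distance of order lam L from p, so the
    modulus of H on a larger set of momenta serves for the envelope. *)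
Lemma moreau_equicontinuous : equicontinuous_in_space Om M.
Proof.
move=> P e e0.
have [r r0 hr] := H_equi (P + d%:R * (2 * lam * `|L|)) e0.
exists r => //.
have half x y : Om x -> Om y -> ball x r y -> forall p : Rd, \sum_i `|p 0 i| <= P ->
    M x p <= M y p + e.
  move=> Ox Oy xy p pP.
  have [q [qp ->]] := moreau_argmin lam0 (lipx Oy) p.
  apply: le_trans (moreau_le lam0 (lipx Ox) p q) _.
  rewrite addrAC lerD2r -lerBlDl; apply: le_trans (ler_norm _) _.
  apply: hr => //; apply: (@le_trans _ _ (\sum_i (`|p 0 i| + 2 * lam * `|L|))).
    apply: ler_sum => i _; rewrite -lerBlDl.
    by apply: le_trans (qp i); exact: lerB_dist.
  by rewrite big_split/= sumr_const card_ord [d%:R * _]mulr_natl lerD2r.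
move=> x y Ox Oy xy p pP.
have h1 := half x y Ox Oy xy p pP; have h2 := half y x Oy Ox (ball_sym xy) p pP.
by rewrite ler_norml; apply/andP; split; lra.
Qed.

Lemma moreau_bounded0 C0 : (forall x, Om x -> `|H x 0| <= C0) ->
  forall x, Om x -> `|M x 0| <= C0 + lam * L ^+ 2 / 2.
Proof.
move=> H0 x Ox; have := H0 x Ox; rewrite !ler_norml => /andP[h1 h2].
have := moreau_ge_self lam0 (lipx Ox) 0; have := moreau_le_self lam0 (lipx Ox) 0.
have : 0 <= lam * L ^+ 2 / 2 by rewrite divr_ge0// mulr_ge0 ?sqr_ge0// ltW.
by move=> h3 h4 h5; apply/andP; split; lra.
Qed.

(** The gradient is a limit of difference quotients, whose rate of convergence is
    given by the quadratic expansion of the envelope. *)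
Lemma measurable_moreau_grad (w : Rd -> Rd) i :
  (forall j, measurable_fun Om (fun x => w x 0 j)) ->
  measurable_fun Om (fun x => grad (M x) (w x) 0 i).
Proof.
move=> mw; pose t n : R := n.+1%:R^-1.
pose q n (x : Rd) := (t n)^-1 * (M x (t n *: delta_mx 0 i + w x) - M x (w x)).
apply: (@measurable_fun_cvg _ _ _ _ q) => [n|x Ox].
  apply: measurable_funM => //; apply: measurable_funB.
    apply: measurable_hamiltonian_gradient moreau_equicontinuous
      moreau_lipschitz_in_gradient _ => j.
    by under eq_fun do rewrite !mxE; exact: measurable_funD.
  exact: measurable_hamiltonian_gradient moreau_equicontinuous
    moreau_lipschitz_in_gradient _.
have [_ quad] := moreau_grad lam0 (lipx Ox) (fun p q s => @H_convex x p q s Ox) (w x).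
apply/cvgrPdist_lt => e e0; have elam0 : 0 < e * (2 * lam) by rewrite !mulr_gt0.
near=> n; have tn0 : 0 < t n by rewrite /t invr_gt0.
have := quad (t n *: delta_mx 0 i + w x); set s := grad _ _.
rewrite addrK dotZr fnormZ fnorm_delta mulr1 (ger0_norm (ltW tn0)).
rewrite dot_delta.
move=> h; rewrite distrC.
have -> : q n x - s 0 i = (t n)^-1 * (M x (t n *: delta_mx 0 i + w x) - M x (w x) - t n * s 0 i).
  by rewrite mulrBr mulKf// gt_eqF.
rewrite normrM gtr0_norm ?invr_gt0//; apply: (@le_lt_trans _ _ ((2 * lam)^-1 * t n)).
  by rewrite ler_pdivrMl// mulrCA -expr2.
rewrite mulrC ltr_pdivrMr ?mulr_gt0//.
by near: n; exact: (near_infty_natSinv_lt (PosNum elam0)).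
Unshelve. all: by end_near. Qed.

End moreau.
End hamiltonian_functions.

(** * The Hamiltonian of the control problem *)

Section control_hamiltonian.
Context (R : realType) (d : nat) (Om : set 'rV[R]_d) (A : metricType R).
Context (b : 'rV[R]_d -> A -> 'rV[R]_d) (f : 'rV[R]_d -> A -> R) (LH : R).
Local Notation Rd := 'rV[R]_d.
Local Notation H := (hamiltonian b f).
Hypothesis LH0 : 0 < LH.
Hypothesis cA : compact [set: A].
Hypothesis ub : unif_continuous_on Om b.
Hypothesis uf : unif_continuous_on Om f.
Hypothesis bLH : drift_sup Om b = LH.
Implicit Types (x y p q : Rd).

Let drift_has_sup : has_sup [set fnorm (b z.1 z.2) | z in closure Om `*` [set: A]].
Proof.
(* A supremum that does not exist has the value 0, so LH > 0 carries the
   boundedness of b and the existence of a control. *)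
apply: contrapT => /sup_out h; move: LH0.
by rewrite -bLH /drift_sup h ltxx.
Qed.

Lemma control_inhabited : exists a : A, True.
Proof. by have [[_ [[x a] _ _]] _] := drift_has_sup; exists a. Qed.

Lemma drift_le x a : closure Om x -> fnorm (b x a) <= LH.
Proof.
move=> Kx; rewrite -bLH; apply: ub_le_sup; first by case: drift_has_sup.
by exists (x, a).
Qed.

Lemma running_cost_bounded x : closure Om x -> exists B, forall a, `|f x a| <= B.
Proof.
move=> Kx.
have cf : continuous (f x).
  move=> a; apply/cvg_ballP => e e0; have [r r0 hr] := uf e0.
  apply: filterS (nbhsx_ballx a r r0) => a' aa'.
  by apply: hr => //; exact: ballxx.
have /compact_bounded[B [Br hB]] := continuous_compact (continuous_subspaceT cf) cA.
exists (B + 1) => a; apply: (hB (B + 1)); first by rewrite ltrDl.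
by exists a.
Qed.

Lemma hamiltonian_has_sup x p : closure Om x ->
  has_sup [set dot (b x a) p - f x a | a in [set: A]].
Proof.
move=> Kx; have [a _] := control_inhabited; have [B fB] := running_cost_bounded Kx.
split; first by exists (dot (b x a) p - f x a), a.
exists (LH * fnorm p + B) => _ [a' _ <-]; apply: lerD.
  apply: le_trans (ler_norm _) _; apply: le_trans (CauchySchwarz_dot _ _) _.
  by rewrite ler_wpM2r ?fnorm_ge0// drift_le.
by apply: le_trans (fB a'); rewrite -normrN ler_norm.
Qed.

Lemma hamiltonian_ge x p a : closure Om x -> dot (b x a) p - f x a <= H x p.
Proof.
move=> Kx; apply: ub_le_sup; last by exists a.
by have [] := hamiltonian_has_sup p Kx.
Qed.

Lemma hamiltonian_le x p c : (forall a, dot (b x a) p - f x a <= c) -> H x p <= c.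
Proof.
move=> h; have [a _] := control_inhabited; apply: ge_sup.
  by exists (dot (b x a) p - f x a), a.
by move=> _ [a' _ <-].
Qed.

Lemma hamiltonian_lip x p q : closure Om x -> H x p <= H x q + LH * fnorm (p - q).
Proof.
move=> Kx; apply: hamiltonian_le => a.
have := hamiltonian_ge q a Kx.
have : dot (b x a) (p - q) <= LH * fnorm (p - q).
  apply: le_trans (ler_norm _) _; apply: le_trans (CauchySchwarz_dot _ _) _.
  by rewrite ler_wpM2r ?fnorm_ge0// drift_le.
by rewrite dotBr; lra.
Qed.

Lemma hamiltonian_convex x p q s : closure Om x -> 0 <= s <= 1 ->
  H x (s *: p + (1 - s) *: q) <= s * H x p + (1 - s) * H x q.
Proof.
move=> Kx /andP[s0 s1]; apply: hamiltonian_le => a; rewrite dotDr !dotZr.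
have := ler_wpM2l s0 (hamiltonian_ge p a Kx).
have s1' : 0 <= 1 - s by rewrite subr_ge0.
have := ler_wpM2l s1' (hamiltonian_ge q a Kx); lra.
Qed.

Lemma hamiltonian_equicontinuous : equicontinuous_in_space (closure Om) H.
Proof.
move=> P e e0; pose e' := e / (`|P| + 1).
have P0 : 0 < `|P| + 1 by rewrite ltr_wpDl.
have e'0 : 0 < e' by rewrite divr_gt0.
have [r1 r10 h1] := ub e'0; have [r2 r20 h2] := uf e'0.
exists (Num.min r1 r2); first by rewrite lt_min r10.
have half x y p : closure Om x -> closure Om y -> ball x (Num.min r1 r2) y ->
    \sum_i `|p 0 i| <= P -> H x p <= H y p + e.
  move=> Kx Ky xy pP; apply: hamiltonian_le => a.
  have := hamiltonian_ge p a Ky.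
  have /ball_rVP[_ bxy] : ball (b x a) e' (b y a).
    apply: h1 => //; last exact: ballxx.
    by apply: le_ball xy; rewrite ge_min lexx.
  have : ball (f x a) e' (f y a).
    apply: h2 => //; last exact: ballxx.
    by apply: le_ball xy; rewrite ge_min lexx orbT.
  rewrite /ball/= => /ltW; rewrite ler_norml => /andP[f1 f2].
  have : dot (b x a - b y a) p <= e' * `|P|.
    apply: (@le_trans _ _ (\sum_i e' * `|p 0 i|)).
      apply: ler_sum => i _; apply: le_trans (ler_norm _) _.
      by rewrite normrM ler_wpM2r// !mxE ltW.
    by rewrite -mulr_sumr ler_wpM2l ?(ltW e'0)// (le_trans pP)// ler_norm.
  have : e' * (`|P| + 1) = e by rewrite divfK// gt_eqF.
  by rewrite dotBl; lra.
move=> x y Kx Ky xy p pP.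
have := half x y p Kx Ky xy pP; have := half y x p Ky Kx (ball_sym xy) pP.
by move=> ? ?; rewrite ler_norml; apply/andP; split; lra.
Qed.

Lemma subdiff_fnorm_le x p c : closure Om x -> subdiff H x p c -> fnorm c <= LH.
Proof.
move=> Kx /(_ (c + p)); rewrite addrK -sqr_fnorm => h1.
have := hamiltonian_lip (c + p) p Kx; rewrite addrK => h2.
have : fnorm c ^+ 2 <= LH * fnorm c by lra.
have [->|c0] := eqVneq (fnorm c) 0; first by move=> _; exact: ltW.
by rewrite expr2 ler_pM2r// lt_neqAle eq_sym c0 fnorm_ge0.
Qed.

End control_hamiltonian.

(** * The estimate *)

Section one_mesh.
Context (R : realType) (d : nat) (Om : set 'rV[R]_d).
Hypotheses (oOm : open Om) (bOm : bounded_set Om).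
Local Notation Rd := 'rV[R]_d.
Local Notation sob := (sobolev R d).
Local Notation L2 f := (Lp Om 2%:E f).
Local Notation VL2 g := (Lp_mx Om 2%:E g).

Let mOm : measurable Om := open_measurable_rV oOm.

Context (A : metricType R) (b : Rd -> A -> Rd) (f : Rd -> A -> R) (LH : R).
Hypothesis LH0 : 0 < LH.
Hypothesis cA : compact [set: A].
Hypothesis ub : unif_continuous_on Om b.
Hypothesis uf : unif_continuous_on Om f.
Hypothesis bLH : drift_sup Om b = LH.
Local Notation H := (hamiltonian b f).

Context (T : seq {ffun 'I_d.+1 -> Rd}) (nu Cstab : R) (D : Rd -> 'M[R]_d).
Hypothesis meshT : mesh Om T.
Hypothesis stabD : stabilization Om D.
Hypothesis Cstab0 : 0 < Cstab.
Hypothesis W_dmp : forall L, W_op Om T LH nu D L -> dmp Om T L.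
Hypothesis W_stable : forall L, W_op Om T LH nu D L -> stable Om T Cstab (adjoint L).

Context (G : sob -> R) (N : R).
Hypothesis HG : Hm1 Om G.
Hypothesis GN : Hm1norm Om G = N%:E.
Hypothesis G0 : Hm1_ge0 Om G.

Lemma KFP_density (c : Rd -> Rd) (m : sob) :
  (forall i, measurable_fun Om (fun x => c x 0 i)) ->
  ae_in Om (fun x => fnorm (c x) <= LH) ->
  Vh Om T m -> KFP_eq Om T nu D c G m ->
  (forall phi, L2 phi -> ae_in Om (fun x => 0 <= phi x) -> 0 <= ip Om phi m.1) /\
  L2norm Om m.1 <= Cstab * N.
Proof.
move=> mc cL Vm KFPm; pose L := advection_diffusion Om nu D c.
have WL : W_op Om T LH nu D L.
  have [Lc cLH] := (Linfty_mx_leP Om c (ltW LH0)).2 (conj mc cL).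
  by exists c.
have Lm w : Vh Om T w -> L w m = G w.
  move=> Vw; rewrite -KFPm// /L (adjoint_advection_diffusionE oOm)//.
    exact: H10_VL2 Vm.1.
  exact: H10_VL2 Vw.1.
split=> [phi Lphi phi0|].
  exact: (discrete_density_ge0 oOm bOm meshT stabD mc cL Cstab0 (W_stable WL) G0
    Vm Lm (W_dmp WL)).
exact: (discrete_density_bound oOm bOm Cstab0 (W_stable WL) Vm Lm HG GN).
Qed.

Context (F : (Rd -> R) -> Rd -> R) (cF lam : R) (u m ul ml : sob).
Hypothesis F_L2 : forall m0, L2 m0 -> L2 (F m0).
Hypothesis F_monotone : coupling_monotone Om F cF.
Hypothesis lam0 : 0 < lam.
Local Notation M := (moreau_yosida H lam).
Hypothesis sol : MFG_PDI_sol Om T nu D H F G u m.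
Hypothesis reg_sol : MFG_reg_sol Om T nu D H F G lam ul ml.

(** Testing the difference of the two Hamilton-Jacobi-Bellman equations with the
    difference of the densities, that of the two Kolmogorov-Fokker-Planck
    equations with the difference of the value functions, and subtracting, the
    diffusion terms cancel by symmetry. What remains expresses the left-hand side
    of the monotonicity of F as the integral of (H[ul] - H_lam[ul]) m, less two
    convexity defects integrated against m and against ml. These two integrals
    are nonnegative, and 0 <= H - H_lam <= lam LH^2 / 2. *)
Lemma density_gap_le : cF * L2norm Om (m.1 \- ml.1) ^+ 2 <=
  lam * LH ^+ 2 / 2 * L2norm Om (fun=> 1) * (Cstab * N).
Proof.
have [Vu Vm [c [[Lc cH] HJBu KFPm]]] := sol.
have [Vul Vml HJBul KFPml] := reg_sol.
have OK : Om `<=` closure Om by exact: subset_closure.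
have lipH : lipschitz_in_gradient Om LH H.
  by move=> x p q /OK Kx; exact: (hamiltonian_lip LH0 cA uf bLH).
have equiK : equicontinuous_in_space (closure Om) H.
  exact: (hamiltonian_equicontinuous LH0 cA ub uf bLH).
have equiH : equicontinuous_in_space Om H.
  move=> P e e0; have [r r0 hr] := equiK P e e0.
  by exists r => // x y /OK Kx /OK Ky; exact: hr.
have convH x p q s : Om x -> 0 <= s <= 1 ->
    H x (s *: p + (1 - s) *: q) <= s * H x p + (1 - s) * H x q.
  by move=> /OK Kx; exact: (hamiltonian_convex LH0 cA uf bLH).
have lipx x : Om x -> forall p q, H x p <= H x q + LH * fnorm (p - q).
  by move=> Ox p q; exact: lipH.
have cvx x (Ox : Om x) p q s := @convH x p q s Ox.
have [C0 H0] := bounded_hamiltonian0 bOm equiK.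
have [Hu Hm] := (Vu.1, Vm.1); have [Hul Hml] := (Vul.1, Vml.1).
have [Lu Lul] := (H10_VL2 Hu, H10_VL2 Hul).
have [Lm Lml] := (H10_L2 Hm, H10_L2 Hml).
have [Lgm Lgml] := (H10_VL2 Hm, H10_VL2 Hml).
pose cl x := grad (M x) (ul.2 x).
have mc i : measurable_fun Om (fun x => c x 0 i) by exact: Lc.1.
have mcl i : measurable_fun Om (fun x => cl x 0 i).
  by apply: (measurable_moreau_grad oOm lam0 equiH lipH convH) => j; exact: Lul.1.
have cL : ae_in Om (fun x => fnorm (c x) <= LH).
  by apply: ae_inS cH => x /OK Kx; exact: (subdiff_fnorm_le LH0 cA uf bLH).
have clL : ae_in Om (fun x => fnorm (cl x) <= LH).
  apply: ae_inW => x Ox.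
  by apply: (moreau_grad_le lam0 (lipx _ Ox) (cvx _ Ox)); exact: ltW.
have [m_ge0 m_le] := KFP_density mc cL Vm KFPm.
have [ml_ge0 _] := KFP_density mcl clL Vml KFPml.
have LHu : L2 (fun x => H x (u.2 x)).
  exact: (L2_hamiltonian_gradient oOm bOm equiH lipH H0 Lu).
have LHul : L2 (fun x => H x (ul.2 x)).
  exact: (L2_hamiltonian_gradient oOm bOm equiH lipH H0 Lul).
have LMul : L2 (fun x => M x (ul.2 x)).
  exact: (L2_hamiltonian_gradient oOm bOm (moreau_equicontinuous lam0 equiH lipH)
    (moreau_lipschitz_in_gradient lam0 lipH) (moreau_bounded0 lam0 lipH H0) Lul).
have Lcu : L2 (fun x => dot (c x) (u.2 x)) by exact: L2_dot cL Lu.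
have Lcul : L2 (fun x => dot (c x) (ul.2 x)) by exact: L2_dot cL Lul.
have Lclu : L2 (fun x => dot (cl x) (u.2 x)) by exact: L2_dot clL Lu.
have Lclul : L2 (fun x => dot (cl x) (ul.2 x)) by exact: L2_dot clL Lul.
have LFm := F_L2 Lm; have LFml := F_L2 Lml.
pose v : sob := (-1) *: ml + m; pose w : sob := (-1) *: ul + u.
have Vv : Vh Om T v by exact: Vh_linear.
have Vw : Vh Om T w by exact: Vh_linear.
have testv h : L2 h -> ip Om h v.1 = - ip Om h ml.1 + ip Om h m.1.
  by move=> Lh; rewrite ipC (@ip_linear _ _ _ mOm (-1) ml.1 m.1)// mulN1r !(ipC _ h).
have testw (e : Rd -> Rd) n : L2 (fun x => dot (e x) (u.2 x)) ->
    L2 (fun x => dot (e x) (ul.2 x)) -> L2 n ->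
    vip Om (fun x => n x *: e x) w.2 =
    - ip Om (fun x => dot (e x) (ul.2 x)) n + ip Om (fun x => dot (e x) (u.2 x)) n.
  move=> L1 L1' Ln; rewrite -mulN1r -ip_linear//.
  apply: eq_Rintegral => x _; rewrite dotZl mulrC; congr (_ * _).
  by rewrite -dotZr -dotDr.
have e1 := HJBu v Vv; have e2 := HJBul v Vv.
have e3 := KFPm w Vw; have e4 := KFPml w Vw.
rewrite !testv// diffusion_linearr// mulN1r in e1.
rewrite !testv// diffusion_linearr// mulN1r in e2.
rewrite testw// diffusion_linearr// mulN1r in e3.
rewrite testw// diffusion_linearr// mulN1r in e4.
have s1 := diffusionC oOm nu stabD Lgm Lu; have s2 := diffusionC oOm nu stabD Lgm Lul.
have s3 := diffusionC oOm nu stabD Lgml Lu; have s4 := diffusionC oOm nu stabD Lgml Lul.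
(* gap1 is the defect of c as a subgradient of H at the gradient of u. *)
have gap1 : 0 <= ip Om (fun x => (H x (ul.2 x) - H x (u.2 x)) -
    (dot (c x) (ul.2 x) - dot (c x) (u.2 x))) m.1.
  apply: m_ge0; first by apply: L2B => //; exact: L2B.
  by apply: ae_inS cH => x Ox /(_ (ul.2 x)); rewrite dotBr; lra.
(* gap2 uses H >= H_lam at the gradient of u and convexity of H_lam at that of ul. *)
have gap2 : 0 <= ip Om (fun x => (H x (u.2 x) - M x (ul.2 x)) -
    (dot (cl x) (u.2 x) - dot (cl x) (ul.2 x))) ml.1.
  apply: ml_ge0; first by apply: L2B => //; exact: L2B.
  apply: ae_inW => x Ox.
  have := moreau_subgradient lam0 (lipx _ Ox) (cvx _ Ox) (ul.2 x) (u.2 x).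
  have := moreau_le_self lam0 (lipx _ Ox) (u.2 x); rewrite -/(cl x) dotBr; lra.
rewrite !ipB// in gap1; try exact: L2B.
rewrite !ipB// in gap2; try exact: L2B.
have := F_monotone Hm Hml.
have Lgap : L2 (fun x => H x (ul.2 x) - M x (ul.2 x)) by exact: L2B.
have -> : ip Om (F m.1 \- F ml.1) (m.1 \- ml.1) =
    ip Om (F m.1) m.1 - ip Om (F m.1) ml.1 - ip Om (F ml.1) m.1 + ip Om (F ml.1) ml.1.
  rewrite ipB//; last exact: L2B.
  rewrite !(ipC _ _ (m.1 \- ml.1)) !ipB// !(ipC _ m.1) !(ipC _ ml.1); lra.
have gap3 : ip Om (fun x => H x (ul.2 x) - M x (ul.2 x)) m.1 <=
    lam * LH ^+ 2 / 2 * L2norm Om (fun=> 1) * (Cstab * N).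
  apply: le_trans (ler_norm _) _; apply: le_trans (CauchySchwarz_ip mOm Lgap Lm) _.
  apply: ler_pM => //; try exact: L2norm_ge0.
  have k0 : 0 <= lam * LH ^+ 2 / 2.
    by rewrite divr_ge0// mulr_ge0 ?sqr_ge0// ltW.
  have L1 := L2_cst oOm bOm 1.
  rewrite -[X in X * _](ger0_norm k0) -L2normZ//; apply: L2norm_le => //.
    exact: L2Z.
  apply: ae_inW => x Ox; rewrite mulr1 (ger0_norm k0).
  have := moreau_ge_self lam0 (lipx _ Ox) (ul.2 x).
  have := moreau_le_self lam0 (lipx _ Ox) (ul.2 x) => h1 h2.
  by rewrite ler_norml; apply/andP; split; lra.
rewrite ipB// in gap3.
lra.
Qed.

End one_mesh.

Unset Implicit Arguments.

Theorem lemma4p4 (R : realType) (d : nat) (Om : set 'rV[R]_d)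
    (cF Cstab LH normG : R) :
  polytopal_domain Om -> 0 < cF -> 0 < Cstab -> 0 < LH ->
  exists C : R,
  forall
    (nu : R) (G : sobolev R d -> R)
    (q : R) (g0 : 'rV[R]_d -> R) (g1 : 'rV[R]_d -> 'rV[R]_d)
    (F : ('rV[R]_d -> R) -> 'rV[R]_d -> R) (LF : R)
    (A : metricType R) (b : 'rV[R]_d -> A -> 'rV[R]_d)
    (f : 'rV[R]_d -> A -> R)
    (T : nat -> seq {ffun 'I_d.+1 -> 'rV[R]_d}) (delta : R)
    (D : nat -> 'rV[R]_d -> 'M[R]_d) (CD : R)
    (lam : nat -> R) (u m ul ml : nat -> sobolev R d),
  0 < nu ->
  Hm1 Om G -> Hm1norm Om G = normG%:E ->
  d%:R < q -> Lp Om (q / 2)%:E g0 -> Lp_mx Om q%:E g1 -> Hm1_rep Om G g0 g1 ->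
  Hm1_ge0 Om G ->
  (forall m0, Lp Om 2%:E m0 -> Lp Om 2%:E (F m0)) ->
  coupling_lipschitz Om F LF -> coupling_monotone Om F cF ->
  compact [set: A] -> unif_continuous_on Om b -> unif_continuous_on Om f ->
  drift_sup Om b = LH ->
  (forall k, mesh Om (T k)) -> (forall k, refines (T k.+1) (T k)) ->
  1 < delta -> (forall k, shape_regular delta (T k)) ->
  Lpnorm Om +oo%E (meshsize (T k)) @[k --> \oo] --> 0%E ->
  (forall k, stabilization Om (D k)) ->
  (forall k, ae_in Om (fun x => fnorm (D k x) <= CD * meshsize (T k) x)) ->
  (forall k L, W_op Om (T k) LH nu (D k) L -> dmp Om (T k) L) ->
  (forall k L, W_op Om (T k) LH nu (D k) L ->
     stable Om (T k) Cstab L /\ stable Om (T k) Cstab (adjoint L)) ->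
  (forall k, 0 < lam k <= 1) -> lam k @[k --> \oo] --> 0 ->
  (forall k, MFG_PDI_sol Om (T k) nu (D k) (hamiltonian b f) F G (u k) (m k)) ->
  (forall k, MFG_reg_sol Om (T k) nu (D k) (hamiltonian b f) F G (lam k)
     (ul k) (ml k)) ->
  forall k, L2norm Om ((m k).1 \- (ml k).1) <= C * lam k `^ 2^-1.
Proof.
move=> [oOm _ bOm _ _] cF0 Cstab0 LH0.
pose C2 := LH ^+ 2 / 2 * L2norm Om (fun=> 1) * (Cstab * normG) / cF.
exists (Num.sqrt C2) => nu G q g0 g1 F LF A b f T delta D CD lam u m ul ml.
move=> _ HG GN _ _ _ _ G0 F_L2 _ F_mon cA ub uf bLH meshT _ _ _ _ stabD _ dmpT stabT.
move=> lam01 _ sol reg_sol k; have /andP[lam0 _] := lam01 k.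
have gap := density_gap_le oOm bOm LH0 cA ub uf bLH (meshT k) (stabD k) Cstab0
  (dmpT k) (fun L WL => (stabT k L WL).2) HG GN G0 F_L2 F_mon lam0 (sol k) (reg_sol k).
have {}gap : L2norm Om ((m k).1 \- (ml k).1) ^+ 2 <= C2 * lam k.
  rewrite -(ler_pM2l cF0); apply: le_trans gap _.
  by rewrite le_eqVlt; apply/orP; left; apply/eqP; rewrite /C2; field; rewrite gt_eqF.
(* The sign of C2 is read off the estimate, as lam k is positive. *)
have C20 : 0 <= C2 by rewrite -(pmulr_lge0 _ lam0) (le_trans _ gap)// sqr_ge0.
rewrite powR12_sqrt; last exact: ltW.
by rewrite -sqrtrM// -[leLHS]ger0_norm ?L2norm_ge0// -sqrtr_sqr ler_wsqrtr.
Qed.
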